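(* Let $T>0$, let $h$ be the enthalpy function with $h(0)=0$, and let $\rho_0:\Omega\to[0,\infty)$ and $\mathbf u_0:\Omega\to\mathbb R^d$ be initial data. Let $\rho:[0,T]\times\Omega\to[0,\infty)$ and $\mathbf u:[0,T]\times\Omega\to\mathbb R^d$, with $\rho,\mathbf u,h(\rho),\rho_0,\mathbf u_0$ smooth and with the flow $\mathbf X_t$ of $\mathbf u$ a diffeomorphism of $\Omega$ for every $t\in[0,T]$. Then $(\rho,\mathbf u)$ satisfies the isentropic compressible Euler system $$\partial_t\rho+(\mathbf u\cdot\nabla)\rho+\rho\,\mathrm{div}\,\mathbf u=0,\qquad \partial_t\mathbf u+(\mathbf u\cdot\nabla)\mathbf u+\nabla h(\rho)=0\quad\text{on }[0,T]\times\Omega,$$ with initial data $(\rho(0,\cdot),\mathbf u(0,\cdot))=(\rho_0,\mathbf u_0)$, if and only if for all $(t,\mathbf x)\in[0,T]\times\Omega$ $$\rho(t,\mathbf x)-\rho_0(\mathbf A_t(\mathbf x))+\int_0^t(\rho\,\mathrm{div}\,\mathbf u)(s,\mathbf A_{t-s}(\mathbf x))\,ds=0$$ and $$\mathbf u(t,\mathbf x)-(\nabla\mathbf A_t(\mathbf x))^{*}\,\mathbf u_0(\mathbf A_t(\mathbf x))+\int_0^t\nabla\Big(h\big(\rho(s,\mathbf A_{t-s}(\mathbf x))\big)-\tfrac12\big|\mathbf u(s,\mathbf A_{t-s}(\mathbf x))\big|^2\Big)\,ds=0,$$ where $\mathbf A$ is the back-to-labels map of $\mathbf u$.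
   Context: Here $\Omega=\mathbb R^d$ or $\Omega=\mathbb T^d=\mathbb R^d/2\pi\mathbb Z^d$, with $d\in\{2,3\}$. The flow $\mathbf X_t$ of $\mathbf u$ is defined by $\frac{d}{dt}\mathbf X_t(\mathbf a)=\mathbf u(t,\mathbf X_t(\mathbf a))$, $\mathbf X_0(\mathbf a)=\mathbf a$. The back-to-labels map is $\mathbf A_t=\mathbf X_t^{-1}$; equivalently it solves $\partial_t\mathbf A_t+(\mathbf u\cdot\nabla)\mathbf A_t=0$, $\mathbf A_0(\mathbf x)=\mathbf x$. For $0\le s\le t$, the notation $\mathbf A_{t-s}(\mathbf x)$ appearing as the spatial argument at time $s$ stands for $\mathbf X_s(\mathbf A_t(\mathbf x))$, i.e. the position at time $s$ of the particle located at $\mathbf x$ at time $t$. $M^*$ is the adjoint (transpose) of a matrix $M$, so $\big((\nabla\mathbf A_t)^*\mathbf v\big)_i=\sum_j\frac{\partial A^j_t}{\partial x^i}v^j$. In the last integral, $\nabla$ is the gradient in $\mathbf x$ of the composed function of $\mathbf x$. *)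

(* Defs.v *)
From mathcomp Require Import all_boot all_order all_algebra.
From mathcomp Require Import all_classical all_reals all_analysis.

Set Implicit Arguments.
Unset Strict Implicit.
Unset Printing Implicit Defensive.

Import Order.TTheory GRing.Theory Num.Theory.
Import numFieldNormedType.Exports.

Local Open Scope classical_set_scope.
Local Open Scope ring_scope.

Inductive domain := WholeSpace | Torus.

(* The space Omega is the quotient of R^d by [lattice Om]: {0} for R^d, and
   2 pi Z^d for the torus. A function on Omega is represented by its pull-back
   to R^d, and a map from Omega to Omega by a lift to R^d. *)
Definition lattice (R : realType) (d : nat) (Om : domain) : set 'rV[R]_d :=
  match Om with
  | WholeSpace => [set 0 : 'rV[R]_d]
  | Torus => [set l : 'rV[R]_d | forall i, exists k : int, l 0 i = 2 * pi * k%:~R]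
  end.

Definition on_domain (R : realType) (d : nat) (Om : domain) (W : Type)
    (f : 'rV[R]_d -> W) : Prop :=
  forall x l, lattice Om l -> f (x + l) = f x.

Fixpoint Ck (R : realType) (V W : normedModType R) (k : nat) (f : V -> W) :
    Prop :=
  match k with
  | 0%N => continuous f
  | k'.+1 => (forall x, differentiable f x) /\
             (forall v, Ck k' (fun x => 'D_v f x))
  end.

Definition smooth (R : realType) (V W : normedModType R) (f : V -> W) : Prop :=
  forall k, Ck k f.

(* Smoothness on the closed set [0, T] x R^d (up to the boundary t = 0, T):
   existence of a smooth extension to R x R^d. *)
Definition smooth_slab (R : realType) (d : nat) (W : normedModType R) (T : R)
    (f : R -> 'rV[R]_d -> W) : Prop :=
  exists g : (R * 'rV[R]_d)%type -> W,
    smooth g /\ forall t x, 0 <= t <= T -> f t x = g (t, x).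

(* F and G are lifts of mutually inverse smooth maps of Omega. *)
Definition inverse_diffeos (R : realType) (d : nat) (Om : domain)
    (F G : 'rV[R]_d -> 'rV[R]_d) : Prop :=
  [/\ smooth F /\ smooth G,
      forall x y, lattice Om (x - y) -> lattice Om (F x - F y),
      forall x y, lattice Om (x - y) -> lattice Om (G x - G y),
      forall x, lattice Om (G (F x) - x) &
      forall x, lattice Om (F (G x) - x)].

(* Time derivatives on [0, T] are one-sided at t = 0 and t = T. *)
Definition time_quotient (R : realType) (W : normedModType R) (f : R -> W)
    (t : R) : R -> W :=
  fun s => (s - t)^-1 *: (f s - f t).

Definition is_ddt (R : realType) (W : normedModType R) (T : R) (f : R -> W)
    (t : R) (l : W) : Prop :=
  time_quotient f t s @[s --> within `[0, T] t^'] --> l.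

Definition ddt (R : realType) (T : R) (f : R -> R) (t : R) : R :=
  lim (time_quotient f t s @[s --> within `[0, T] t^']).

Definition partial (R : realType) (d : nat) (i : 'I_d) (f : 'rV[R]_d -> R)
    (x : 'rV[R]_d) : R :=
  'D_(delta_mx 0 i : 'rV[R]_d) f x.

Definition grad (R : realType) (d : nat) (f : 'rV[R]_d -> R) (x : 'rV[R]_d) :
    'rV[R]_d :=
  \row_i partial i f x.

Definition div (R : realType) (d : nat) (v : 'rV[R]_d -> 'rV[R]_d)
    (x : 'rV[R]_d) : R :=
  \sum_i partial i (fun y => v y 0 i) x.

Definition advect (R : realType) (d : nat) (v : 'rV[R]_d) (f : 'rV[R]_d -> R)
    (x : 'rV[R]_d) : R :=
  \sum_i v 0 i * partial i f x.

Definition grad_adjoint (R : realType) (d : nat) (A : 'rV[R]_d -> 'rV[R]_d)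
    (x v : 'rV[R]_d) : 'rV[R]_d :=
  \row_i \sum_j partial i (fun y => A y 0 j) x * v 0 j.

(* The square of the Euclidean norm; the library norm on row vectors is the
   maximum norm. *)
Definition sqnorm (R : realType) (d : nat) (v : 'rV[R]_d) : R :=
  \sum_i v 0 i ^+ 2.

Definition is_flow (R : realType) (d : nat) (T : R)
    (u X : R -> 'rV[R]_d -> 'rV[R]_d) : Prop :=
  forall a, X 0 a = a /\
    forall t, 0 <= t <= T -> is_ddt T (fun s => X s a) t (u t (X t a)).

Definition euler_system (R : realType) (d : nat) (T : R) (h : R -> R)
    (rho : R -> 'rV[R]_d -> R) (u : R -> 'rV[R]_d -> 'rV[R]_d) : Prop :=
  forall t x, 0 <= t <= T ->
    ddt T (fun s => rho s x) t + advect (u t x) (rho t) x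
      + rho t x * div (u t) x = 0 /\
    forall j, ddt T (fun s => u s x 0 j) t
      + advect (u t x) (fun y => u t y 0 j) x
      + grad (fun y => h (rho t y)) x 0 j = 0.

(* Position at time s of the particle located at x at time t. *)
Definition position_at (R : realType) (d : nat)
    (X A : R -> 'rV[R]_d -> 'rV[R]_d) (s t : R) (x : 'rV[R]_d) : 'rV[R]_d :=
  X s (A t x).

Definition density_formula (R : realType) (d : nat) (T : R)
    (rho0 : 'rV[R]_d -> R) (rho : R -> 'rV[R]_d -> R)
    (u X A : R -> 'rV[R]_d -> 'rV[R]_d) : Prop :=
  forall t x, 0 <= t <= T ->
    rho t x - rho0 (A t x)
      + \int[lebesgue_measure]_(s in `[0, t])
          (rho s (position_at X A s t x) * div (u s) (position_at X A s t x))
    = 0.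

Definition velocity_formula (R : realType) (d : nat) (T : R) (h : R -> R)
    (u0 : 'rV[R]_d -> 'rV[R]_d) (rho : R -> 'rV[R]_d -> R)
    (u X A : R -> 'rV[R]_d -> 'rV[R]_d) : Prop :=
  forall t x, 0 <= t <= T -> forall i,
    u t x 0 i - grad_adjoint (A t) x (u0 (A t x)) 0 i
      + \int[lebesgue_measure]_(s in `[0, t])
          grad (fun y => h (rho s (position_at X A s t y))
                         - 2^-1 * sqnorm (u s (position_at X A s t y))) x 0 i
    = 0.

(* Main.v *)
(** Along the flow both equations become ordinary differential equations in time.
    Density: d/dt rho(t, X_t a) is the material derivative of rho. Velocity
    (Weber): put W_j(t) = sum_k u_k(t, X_t a) d_j X_t^k(a), that is
    W = (grad X_t)^* u. The variational equation d/dt grad X_t = grad u grad X_t gives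
      W_j' + d_j ((h(rho) - |u|^2 / 2)(t, X_t a))
        = sum_k d_j X_t^k (D_t u_k + d_k h(rho)),
    so, grad X_t being invertible, the momentum equation holds along the
    trajectory iff W_j(t) - u0_j(a) + int_0^t d_j ((h(rho) - |u|^2 / 2)(s, X_s a)) ds = 0.
    Multiplying this by (grad A_t(x))^*, the inverse of (grad X_t)^*, at a = A_t x
    gives the velocity formula.

    No joint regularity of X is assumed, so the variational equation is proved
    from a local Gronwall estimate and the mean value theorem. On the torus X_t
    and A_t are inverse to each other only modulo the lattice, which is discrete,
    so both compositions are translations. *)
Require Import Defs.
From mathcomp Require Import all_boot all_order all_algebra.
From mathcomp Require Import all_classical all_reals all_analysis.
From mathcomp Require Import ring lra.
Import Order.TTheory GRing.Theory Num.Theory.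
Import numFieldNormedType.Exports.
Local Open Scope classical_set_scope.
Local Open Scope ring_scope.

(** * One-sided and two-sided time derivatives *)

(** This epsilon-delta form has the same shape as [is_deriveP], except that [s] is confined to
    [[0, T]]; transfers between the two notions reduce to comparing the forms. *)
Lemma is_ddtP (R : realType) (W : normedModType R) (T : R) (f : R -> W) (t : R)
    (l : W) :
  is_ddt T f t l <-> forall e : R, 0 < e -> exists2 r : R, 0 < r & forall s : R,
    0 <= s <= T -> `|s - t| < r -> s != t -> `|l - time_quotient f t s| <= e.
Proof.
split.
  move/cvgrPdist_le => H e e0; have := H e e0.
  rewrite near_withinE near_withinE => /nbhs_ballP[r /= r0 B].
  exists r => // s sT st snt; have := B s; rewrite /ball /= distrC; exact.
move=> H; apply/cvgrPdist_le => e e0; have [r r0 B] := H e e0.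
rewrite near_withinE near_withinE; apply/nbhs_ballP; exists r => //= s.
rewrite /ball /= distrC => st snt; rewrite in_itv /= => sT; exact: B.
Qed.

Lemma is_deriveP (R : realType) (W : normedModType R) (f : R -> W) (t : R)
    (l : W) :
  is_derive t 1 f l <-> forall e : R, 0 < e -> exists2 r : R, 0 < r & forall s : R,
    `|s - t| < r -> s != t -> `|l - time_quotient f t s| <= e.
Proof.
have E : (fun h => h^-1 *: (f (h *: 1 + t) - f t)) = time_quotient f t \o (+%R^~ t).
  by apply/funext => h; rewrite /time_quotient /= addrK /GRing.scale /= mulr1.
split.
  move=> [df lf] e e0.
  have cl : (time_quotient f t \o (+%R^~ t)) x @[x --> 0^'] --> l.
    by rewrite -lf /derive -E.
  move/cvgrPdist_le: cl => /(_ e e0); rewrite near_withinE => /nbhs_ballP[r /= r0 B].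
  exists r => // s st snt; have := B (s - t); rewrite /ball /= sub0r normrN subrK.
  by apply => //; rewrite subr_eq0.
move=> H.
have cl : (time_quotient f t \o (+%R^~ t)) x @[x --> 0^'] --> l.
  apply/cvgrPdist_le => e e0; have [r r0 B] := H e e0.
  rewrite near_withinE; apply/nbhs_ballP; exists r => //= s.
  rewrite /ball /= sub0r normrN => sr s0; apply: B; first by rewrite addrK.
  by rewrite -subr_eq0 addrK.
apply: DeriveDef; first by rewrite /derivable E; apply/cvg_ex; exists l.
by rewrite /derive E; exact/cvg_lim.
Qed.

Lemma is_derive_is_ddt (R : realType) (W : normedModType R) (T : R) (F f : R -> W)
    (t : R) (l : W) :
  0 <= t <= T -> (forall s : R, 0 <= s <= T -> F s = f s) -> is_derive t 1 F l ->
  is_ddt T f t l.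
Proof.
move=> tT Ff /is_deriveP H; apply/is_ddtP => e e0; have [r r0 B] := H e e0.
exists r => // s sT st snt.
by have := B s st snt; rewrite /time_quotient !Ff.
Qed.

(* One-sided derivatives at the ends of [0, T] become two-sided ones after an
   affine extension, so that the usual calculus applies on all of [0, T]. *)
Lemma is_ddt_extend (R : realType) (W : normedModType R) (T : R) (f l : R -> W) :
  0 < T -> (forall t : R, 0 <= t <= T -> is_ddt T f t (l t)) ->
  exists F : R -> W, (forall s : R, 0 <= s <= T -> F s = f s) /\
    forall t : R, 0 <= t <= T -> is_derive t 1 F (l t).
Proof.
move=> T0 fl.
pose F s := if s < 0 then f 0 + s *: l 0 else
  if T < s then f T + (s - T) *: l T else f s.
have FE s : 0 <= s <= T -> F s = f s.
  by move=> /andP[s0 sT]; rewrite /F !ltNge s0 sT.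
exists F; split => // t tT; apply/is_deriveP => e e0.
have [r r0 B] := (is_ddtP _ _ _ _ _ _).1 (fl t tT) e e0.
(* For [t > 0] the radius excludes [s < 0], and for [t < T] it excludes [s > T]. An affine piece is
   thus met only from its own endpoint, where its difference quotient is exactly [l t]. *)
exists (Num.min r (Num.min (if t == 0 then r else t) (if t == T then r else T - t))).
  case/andP: tT => t0 tT.
  rewrite !lt_min r0 /=; case: ifPn => [_|tn0]; case: ifPn => [_|tnT];
   rewrite ?r0 ?subr_gt0 ?lt_neqAle ?tnT ?tT 1?eq_sym ?tn0 ?t0 //.
move=> s; rewrite !lt_min => /and3P[sr s0 sT] snt.
rewrite /time_quotient (FE t) //.
have [s_lt0|s_ge0] := ltP s 0.
  rewrite /F s_lt0; move: s0; case: ifPn => [/eqP -> _|tn0].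
    by rewrite subr0 addrAC subrr add0r scalerA mulVf ?scale1r ?subrr ?normr0 ?ltW// lt_eqF.
  case/andP: tT => t0 tT.
  rewrite ler0_norm ?subr_le0 ?(le_trans (ltW s_lt0))// opprB ltrBlDr ltrDl.
  by rewrite ltNge (ltW s_lt0).
have [T_lt|s_leT] := ltP T s.
  rewrite /F ltNge s_ge0 /= T_lt; move: sT; case: ifPn => [/eqP -> _|tnT].
    by rewrite addrAC subrr add0r scalerA mulVf ?scale1r ?subrr ?normr0 ?ltW// subr_eq0 gt_eqF.
  case/andP: tT => t0 tT.
  by rewrite ger0_norm ?subr_ge0 ?(le_trans tT (ltW _))// ltrD2r ltNge (ltW T_lt).
by rewrite (FE s) ?s_ge0 ?s_leT //; apply: B => //; rewrite s_ge0.
Qed.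

(** Uniqueness of the limit needs the filter to be proper: since [0 < T], every neighbourhood of [t]
    contains another point of [[0, T]], to the right if [t = 0] and to the left otherwise. *)
Lemma ddt_val (R : realType) (T : R) (f : R -> R) (t l : R) :
  0 < T -> 0 <= t <= T -> is_ddt T f t l -> ddt T f t = l.
Proof.
move=> T0 tT fl; apply: cvg_lim => //.
apply: Build_ProperFilter_ex => B.
move=> /nbhs_ballP[r /= r0 H].
suff [s [sT st snt]] : exists s, [/\ 0 <= s <= T, `|t - s| < r & s != t].
  by exists s; apply: H => //=; rewrite in_itv.
case/andP: tT; rewrite le_eqVlt => /predU1P[<- _|t0 tT].
  have m0 : 0 < Num.min (r / 2) T by rewrite lt_min divr_gt0.
  exists (Num.min (r / 2) T); rewrite ltW //= ge_min lexx orbT gt_eqF //; split => //.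
  rewrite sub0r normrN gtr0_norm // gt_min; apply/orP; left.
  by rewrite ltr_pdivrMr // ltr_pMr // ltr1n.
have m0 : 0 < Num.min (r / 2) t by rewrite lt_min divr_gt0.
exists (t - Num.min (r / 2) t).
rewrite subr_ge0 ge_min lexx orbT /= (le_trans _ tT) ?gerBl ?ltW //; split => //.
  rewrite opprB addrC subrK gtr0_norm // gt_min; apply/orP; left.
  by rewrite ltr_pdivrMr // ltr_pMr // ltr1n.
by rewrite lt_eqF // ltrBlDr ltrDl.
Qed.

Lemma is_derive_continuous (R : realType) (W : normedModType R) (f : R -> W)
    (t : R) (l : W) :
  is_derive t 1 f l -> {for t, continuous f}.
Proof.
by move=> [/derivable1_diffP df _]; apply: differentiable_continuous.
Qed.

(** * Coordinates, chain rules and mean values on time-space *)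

Lemma is_derive_coord (R : realType) (V : normedModType R) (d : nat)
    (f : V -> 'rV[R]_d) (x v : V) (l : 'rV[R]_d) (j : 'I_d) :
  is_derive x v f l -> is_derive x v (fun y => f y 0 j) (l 0 j).
Proof.
move=> [df <-]; apply: DeriveDef; first exact: (derivable_mxP f x v).1.
by rewrite derive_mx // mxE.
Qed.

Lemma Ck1_coord (R : realType) (V : normedModType R) (d : nat)
    (g : V -> 'rV[R]_d) (j : 'I_d) :
  Ck 1 g -> Ck 1 (fun p => g p 0 j).
Proof.
move=> [dg cg]; split => [x|v].
  exact: (differentiable_comp (dg x) (differentiable_coord _ _ _)).
rewrite /= (_ : (fun x => _) = (fun M : 'rV[R]_d => M 0 j) \o (fun x => 'D_v g x)).
  move=> x; apply: continuous_comp; first exact: cg.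
  exact: coord_continuous.
apply/funext => x /=; rewrite [in RHS]derive_mx ?mxE //.
exact: diff_derivable.
Qed.

Lemma diff_time_space (R : realType) (d : nat) (G : (R * 'rV[R]_d)%type -> R)
    (p : (R * 'rV[R]_d)%type) (a : R) (v : 'rV[R]_d) :
  differentiable G p ->
  'd G p (a, v) = a * 'D_(1, 0) G p + \sum_i v 0 i * 'D_(0, delta_mx 0 i) G p.
Proof.
move=> dG; rewrite !deriveE //.
have -> : (a, v) = a *: (1, 0) + \sum_i v 0 i *: (0, delta_mx 0 i) :> (R * 'rV[R]_d)%type.
  have -> : \sum_i v 0 i *: (0, delta_mx 0 i) = (0, v) :> (R * 'rV[R]_d)%type.
    apply: injective_projections; rewrite ?(raddf_sum (@fst _ _)) ?(raddf_sum (@snd _ _)) /=.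
      by rewrite big1 // => i _; rewrite scaler0.
    by rewrite [RHS]row_sum_delta.
  by apply: injective_projections => /=; rewrite ?addr0 ?scaler0 ?add0r // /GRing.scale /= mulr1.
rewrite linearD linearZ linear_sum; congr (_ + _).
by apply: eq_bigr => i _; rewrite linearZ deriveE.
Qed.

Lemma is_derive_time_space (R : realType) (d : nat)
    (G : (R * 'rV[R]_d)%type -> R) (a : R -> R) (c : R -> 'rV[R]_d) (t a' : R)
    (v : 'rV[R]_d) :
  differentiable G (a t, c t) -> is_derive t 1 a a' -> is_derive t 1 c v ->
  is_derive t 1 (fun s => G (a s, c s))
    (a' * 'D_(1, 0) G (a t, c t)
      + \sum_i v 0 i * 'D_(0, delta_mx 0 i) G (a t, c t)).
Proof.
move=> dG [/derivable1_diffP da aE] [/derivable1_diffP dc cE].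
have dac := differentiable_pair da dc.
have dGac : differentiable (G \o (fun s => (a s, c s))) t by exact: differentiable_comp.
apply: DeriveDef; first exact/derivable1_diffP.
rewrite deriveE // diff_comp // diff_pair //= -!deriveE // aE cE.
by rewrite deriveE // diff_time_space.
Qed.

Lemma derive_space (R : realType) (d : nat) (W : normedModType R)
    (G : (R * 'rV[R]_d)%type -> W) (t : R) (x v : 'rV[R]_d) :
  'D_v (fun y => G (t, y)) x = 'D_(0, v) G (t, x).
Proof.
rewrite /derive; do 2 f_equal; apply/funext => h /=.
congr (_ *: (G _ - _)); apply: injective_projections => //=.
by rewrite scaler0 add0r.
Qed.

Lemma derive_time (R : realType) (d : nat) (G : (R * 'rV[R]_d)%type -> R) (t : R)
    (x : 'rV[R]_d) :
  differentiable G (t, x) -> is_derive t 1 (fun s => G (s, x)) ('D_(1, 0) G (t, x)).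
Proof.
move=> dG; apply: is_derive_eq; first by apply: is_derive_time_space; first exact: dG.
by rewrite mul1r big1 ?addr0 // => i _; rewrite mxE mul0r.
Qed.

Lemma differentiable_space (R : realType) (V : normedModType R) (d : nat)
    (G : (R * 'rV[R]_d)%type -> R) (t : R) (f : V -> 'rV[R]_d) (x : V) :
  differentiable G (t, f x) -> differentiable f x ->
  differentiable (fun y => G (t, f y)) x.
Proof.
move=> dG df; apply: (@differentiable_comp _ _ _ _ (fun y => (t, f y)) G) => //.
exact: differentiable_pair.
Qed.

Lemma derive_rV_comp (R : realType) (V : normedModType R) (d : nat)
    (f : 'rV[R]_d -> R) (A : V -> 'rV[R]_d) (x v : V) :
  differentiable f (A x) -> differentiable A x ->
  'D_v (fun y => f (A y)) x =
    \sum_j 'D_v (fun y => A y 0 j) x * 'D_(delta_mx 0 j) f (A x).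
Proof.
move=> df dA.
rewrite deriveE; last exact: (@differentiable_comp _ _ _ _ A f).
rewrite (@diff_comp _ _ _ _ A f) //= -(@deriveE _ _ _ A) //.
rewrite derive_mx; last exact: diff_derivable.
rewrite [X in 'd f _ X]row_sum_delta linear_sum; apply: eq_bigr => j _.
by rewrite linearZ -deriveE // !mxE.
Qed.

Lemma derive_space_comp (R : realType) (V : normedModType R) (d : nat)
    (G : (R * 'rV[R]_d)%type -> R) (t : R) (f : V -> 'rV[R]_d) (x v : V) :
  differentiable G (t, f x) -> differentiable f x ->
  'D_v (fun y => G (t, f y)) x =
    \sum_k 'D_v (fun y => f y 0 k) x * 'D_(0, delta_mx 0 k) G (t, f x).
Proof.
move=> dG df; rewrite (derive_rV_comp R V d (fun z => G (t, z)) f) //; last first.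
  exact: (differentiable_space R _ d G t id).
by apply: eq_bigr => k _; rewrite derive_space.
Qed.

(** The scalar mean value theorem on the segment from [x] to [y]. The intermediate point depends on
    [G], so vector fields are treated one coordinate at a time. *)
Lemma MVT_space (R : realType) (d : nat) (G : (R * 'rV[R]_d)%type -> R) (s : R)
    (x y : 'rV[R]_d) :
  (forall p, differentiable G p) ->
  exists2 th, 0 <= th <= 1 & G (s, y) - G (s, x) =
    \sum_k (y - x) 0 k * 'D_(0, delta_mx 0 k) G (s, x + th *: (y - x)).
Proof.
move=> dG.
pose c (th : R) := x + th *: (y - x).
have dc (th : R) : is_derive th 1 c (y - x).
  have dl : is_derive th 1 ( *:%R^~ (y - x)) (y - x).
    by apply: DeriveDef; [exact/derivable1_diffP|rewrite deriveE // diff_val scale1r].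
  have dx : is_derive th 1 (cst x : R -> 'rV[R]_d) 0 by exact: is_derive_cst.
  by have := is_deriveD dx dl; rewrite add0r.
pose df (th : R) := \sum_k (y - x) 0 k * 'D_(0, delta_mx 0 k) G (s, c th).
have dGc (th : R) : is_derive th 1 (fun th => G (s, c th)) (df th).
  apply: is_derive_eq; first exact: (is_derive_time_space R d G (cst s) c th).
  by rewrite mul0r add0r.
have [|th + E] := @MVT_segment R (fun th => G (s, c th)) df 0 1 ler01 (fun th _ => dGc th).
  by apply: derivable_within_continuous => th _; case: (dGc th).
rewrite in_itv /= => th01; exists th => //.
by move: E; rewrite subr0 mulr1 /df /c scale1r scale0r addr0 (addrC x (y - x)) subrK => <-.
Qed.

(** The translation [c] covers lifts of the identity of the torus; the lemma serves both for [X 0]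
    and for the composition of [X t] with [A t]. *)
Lemma derive_id_coord (R : realType) (d : nat) (f : 'rV[R]_d -> 'rV[R]_d)
    (c x : 'rV[R]_d) (i k : 'I_d) :
  (forall y, f y = y + c) -> 'D_(delta_mx 0 i) (fun y => f y 0 k) x = (i == k)%:R.
Proof.
move=> fE; have -> : f = id + cst c by apply/funext.
have H : is_derive x (delta_mx 0 i : 'rV[R]_d) (@id 'rV[R]_d + cst c) (delta_mx 0 i + 0).
  exact: is_deriveD.
have := is_derive_coord R _ d _ x _ _ k H => H'.
by rewrite derive_val addr0 !mxE eqxx eq_sym.
Qed.

(** * Integral equations in time and their differential form *)

Lemma continuous_segment_integrable (R : realType) (T : R) (q : R -> R) (t : R) :
  (forall t : R, 0 <= t <= T -> {for t, continuous q}) -> t <= T ->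
  (@lebesgue_measure R).-integrable `[0, t] (EFin \o q).
Proof.
move=> cq tT; apply: continuous_compact_integrable; first exact: segment_compact.
apply: continuous_in_subspaceT => s; rewrite inE /= in_itv /= => /andP[s0 st].
by apply: cq; rewrite s0 (le_trans st).
Qed.

(** Both directions are the fundamental theorem of calculus. Nothing is known of [q] outside
    [[0, T]], so differentiating the integral at the endpoints requires a continuous extension of
    [q]. *)
Lemma integral_eq_iff_derive_eq (R : realType) (T : R) (f f' q : R -> R) (f0 : R) :
  0 < T -> (forall t : R, 0 <= t <= T -> is_derive t 1 f (f' t)) ->
  (forall t : R, 0 <= t <= T -> {for t, continuous q}) ->
  (forall t : R, 0 <= t <= T ->
    f t - f0 + \int[lebesgue_measure]_(s in `[0, t]) q s = 0) <->
  (f 0 = f0 /\ forall t : R, 0 <= t <= T -> f' t + q t = 0).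
Proof.
move=> T0 df cq; split; last first.
  move=> [<- fq] t /andP[t_ge0 tT].
  have [<-|t0] := eqVneq 0 t; first by rewrite set_itv1 Rintegral_set1 subrr addr0.
  have t_gt0 : 0 < t by rewrite lt_neqAle t0.
  have inT (s : R) : 0 <= s <= t -> 0 <= s <= T.
    by move=> /andP[-> st]; exact: le_trans tT.
  (* The equation makes [- f] a primitive of [q]. *)
  rewrite /Rintegral (@continuous_FTC2 _ _ (- f) _ _ t_gt0) /=.
  - by rewrite /= [(- f) t]/(- f t) [(- f) 0]/(- f 0) opprK addrACA subrr addNr addr0.
  - apply: continuous_in_subspaceT => s; rewrite inE /= in_itv /= => s0t.
    exact/cq/inT.
  - split.
    + move=> s; rewrite in_itv /= => /andP[s0 st]; apply: derivableN.
      by case: (df s) => //; apply: inT; rewrite !ltW.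
    + apply: cvg_at_right_filter; apply: continuousN.
      by apply: (is_derive_continuous _ _ _ _ _ (df _ _)); apply: inT; rewrite lexx.
    + apply: cvg_at_left_filter; apply: continuousN.
      by apply: (is_derive_continuous _ _ _ _ _ (df _ _)); apply: inT; rewrite lexx t_ge0.
  - move=> s; rewrite in_itv /= => /andP[s0 st].
    have sT : 0 <= s <= T by apply: inT; rewrite !ltW.
    have [dfs fE] := df s sT.
    rewrite derive1E deriveN // fE.
    by have /eqP := fq s sT; rewrite addrC addr_eq0 => /eqP ->.
move=> H; split.
  have := H 0; rewrite lexx ltW // set_itv1 Rintegral_set1 addr0 => /(_ isT) /eqP.
  by rewrite subr_eq0 => /eqP.
move=> t tT.
(* Clamping the argument to [[0, T]] makes [q] continuous on the whole line without changing it on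
   [[0, T]]. *)
pose qc s := q (Num.max 0 (Num.min s T)).
have qcE (s : R) : 0 <= s <= T -> qc s = q s.
  by move=> /andP[s0 sT]; rewrite /qc min_l // max_r.
have cqc : continuous qc.
  move=> s; apply: (@continuous_comp _ _ _ (fun s => Num.max 0 (Num.min s T)) q).
    apply: continuous_max; first exact: cst_continuous.
    apply: continuous_min; last exact: cst_continuous.
    exact: cvg_id.
  by apply: cq; rewrite le_max lexx /= ge_max ltW //= ge_min lexx orbT.
have iqc a b : (@lebesgue_measure R).-integrable `[a, b] (EFin \o qc).
  apply: continuous_compact_integrable; first exact: segment_compact.
  exact: continuous_subspaceT.
(* With lower bound -1, the point [t] is interior to the segment from -1 to [t + 1] even when
   [t = 0]. *)
pose Q x := \int[lebesgue_measure]_(s in `[-1, x]) qc s.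
have dQ : is_derive t 1 Q (qc t).
  have tN1 : -1 < t by case/andP: tT => t0 _; apply: lt_le_trans t0; rewrite oppr_lt0.
  have t1 : t < t + 1 by rewrite ltrDl.
  have [dQ QE] := @continuous_FTC1_closed R qc (-1) t (t + 1) t1 (iqc _ _) tN1 (cqc t).
  by rewrite derive1E in QE; exact: DeriveDef dQ QE.
have QI (s : R) : 0 <= s <= T -> Q s = Q 0 + \int[lebesgue_measure]_(s in `[0, s]) q s.
  move=> /andP[s0 sT].
  have -> : \int[lebesgue_measure]_(s in `[0, s]) q s =
      \int[lebesgue_measure]_(s in `[0, s]) qc s.
    apply: eq_Rintegral => x; rewrite inE /= in_itv /= => /andP[x0 xs].
    by rewrite qcE // x0 (le_trans xs).
  have := @Rintegral_itvB R qc (BLeft (-1)) (BRight s) 0 (iqc _ _).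
  rewrite -/(Q 0) -/(Q s) !bnd_simp s0 lerN10 => /(_ isT isT).
  rewrite Rintegral_itv_obnd_cbnd => [<-|]; first by rewrite addrC subrK.
  by apply: (integrableS _ _ _ (iqc 0 s)) => //; exact: subset_itv_oc_cc.
(* On [[0, T]] the hypothesis says that [f + Q] is the constant [f0 + Q 0]. Its derivative within
   [[0, T]] is both [f' t + qc t] and 0, and [ddt_val] identifies the two. *)
have d1 : is_ddt T (cst (f0 + Q 0)) t (f' t + qc t).
  apply: (is_derive_is_ddt R R T (fun s => f s + Q s) _ t _ tT).
    move=> s sT; rewrite QI //; have := H s sT.
    set I := Rintegral _ _ _ => E.
    by apply/eqP; rewrite -subr_eq0 -E; apply/eqP; rewrite /cst; ring.
  by have := df t tT; move=> ?; exact: is_deriveD.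
have d2 : is_ddt T (cst (f0 + Q 0)) t 0.
  by apply: (@is_derive_is_ddt _ _ _ (cst (f0 + Q 0)) _ _ _ tT).
by rewrite -(ddt_val _ _ _ _ _ T0 tT d2) -(qcE t) //; apply/esym/ddt_val.
Qed.

(** * Lattice-valued displacements *)

(** On the torus a nonzero coordinate is 2 pi k with k a nonzero integer, hence at least 1 in
    absolute value. *)
Lemma lattice_discrete (R : realType) (d : nat) (Om : domain) (l : 'rV[R]_d) :
  lattice Om l -> `|l| < 1 -> l = 0.
Proof.
case: Om => //= H l1; apply/rowP => i; rewrite mxE; have [k lk] := H i.
have li : `|l 0 i| < 1.
  apply: le_lt_trans l1; rewrite [leRHS]/Num.Def.normr /= mx_normrE.
  exact: (le_bigmax _ _ (0, i)).
rewrite lk; have [->|k0] := eqVneq k 0; first by rewrite mulr0.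
suff : 1 <= `|2 * pi * k%:~R : R| by rewrite leNgt -lk li.
have k1 : 1 <= `|k%:~R : R| by apply: norm_intr_ge1; rewrite ?intr_eq0 ?intr_int.
have p1 : 1 <= `|2 * pi : R| by have := pi_ge2 R => p2; rewrite ger0_norm; lra.
rewrite normrM; nra.
Qed.

(** Along a segment the displacement [f z - z] is continuous with values in a discrete set, hence
    constant. *)
Lemma lattice_valued_constant (R : realType) (d : nat) (Om : domain)
    (f : 'rV[R]_d -> 'rV[R]_d) :
  continuous f -> (forall x, lattice Om (f x - x)) ->
  exists2 c, lattice Om c & forall x, f x = x + c.
Proof.
move=> cf fl.
have fxy x y : f x - x = f y - y.
  pose k (s : R) := let z := y + s *: (x - y) in f z - z.
  have ck : continuous k.
    move=> s; have cz : {for s, continuous (fun s : R => y + s *: (x - y))}.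
      apply: continuousD; first exact: cst_continuous.
      exact: scalel_continuous.
    apply: (@continuousB _ _ _ (fun s : R => f (y + s *: (x - y)))) => //.
    by apply: continuous_comp => //; exact: cf.
  have kl (s s' : R) : `|k s - k s'| < 1 -> k s = k s'.
    move=> /lattice_discrete kk; apply/eqP; rewrite -subr_eq0; apply/eqP.
    apply: (kk Om); rewrite /k /=.
    move: (fl (y + s *: (x - y))) (fl (y + s' *: (x - y))).
    case: (Om) => /= [-> ->|H H' i]; first by rewrite subr0.
    have [m mE] := H i; have [m' mE'] := H' i.
    exists (m - m'); rewrite mxE [in X in _ + X]mxE mE mE' intrB; ring.
  suff : k 1 = k 0 by rewrite /k /= scale1r scale0r addr0 (addrC y) subrK.
  (* Discreteness and continuity make [k] locally constant, so each coordinate has zero derivative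
     everywhere. *)
  apply/rowP => i.
  apply: (@is_derive_0_is_cst R (fun s : R => k s 0 i) 1 0) => s.
  have H : is_derive s (1 : R) (cst (k s 0 i)) 0 by exact: is_derive_cst.
  refine (near_eq_is_derive _ H).
  have /cvgrPdist_lt /(_ 1 ltr01) := ck s.
  by apply: filterS => s' /kl ->.
exists (f 0 - 0) => // x.
by rewrite -(fxy x) addrC subrK.
Qed.

(** * Norm bounds and Lipschitz estimates on compact slabs *)

Lemma rV_coord_le (R : realType) (d : nat) (v : 'rV[R]_d) (i : 'I_d) :
  `|v 0 i| <= `|v|.
Proof.
by rewrite [leRHS]/Num.Def.normr /= mx_normrE; exact: (le_bigmax _ _ (0, i)).
Qed.

Lemma rV_norm_le (R : realType) (d : nat) (v : 'rV[R]_d) (e : R) :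
  0 <= e -> (forall i, `|v 0 i| <= e) -> `|v| <= e.
Proof.
move=> e0 H; rewrite [leLHS]/Num.Def.normr /= mx_normrE.
by apply: bigmax_le => // -[i j] _ /=; rewrite ord1.
Qed.

Lemma bounded_on_compact (R : realType) (U : topologicalType) (f : U -> R)
    (K : set U) :
  compact K -> {within K, continuous f} ->
  exists2 B : R, 0 <= B & forall x, K x -> `|f x| <= B.
Proof.
move=> cK cf; have /compact_bounded[M [_ H]] := continuous_compact cf cK.
exists (`|M| + 1); first by rewrite addr_ge0.
move=> x Kx; apply: (H (`|M| + 1)); last by exists x.
by rewrite (le_lt_trans (ler_norm _)) // ltrDl.
Qed.

(** The spatial partial derivatives are bounded on the compact product of [[0, T]] and the closed
    ball of radius [M]; the sum of these bounds is a Lipschitz constant by the mean value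
    theorem. *)
Lemma slab_lipschitz (R : realType) (d : nat) (G : (R * 'rV[R]_d)%type -> R)
    (T M : R) :
  Ck 1 G -> exists2 L : R, 0 <= L & forall (s : R) (x y : 'rV[R]_d),
    0 <= s <= T -> `|x| <= M -> `|y| <= M ->
    `|G (s, y) - G (s, x)| <= L * `|y - x|.
Proof.
move=> [dG cG].
have cB : compact [set x : 'rV[R]_d | `|x| <= M].
  apply: bounded_closed_compact.
    by exists M; split; [exact: num_real|move=> N MN x /= xM; apply: le_trans (ltW MN)].
  rewrite (_ : [set x | _] = (fun x : 'rV[R]_d => `|x|) @^-1` [set r | r <= M]) //.
  by apply: closed_comp; [move=> x _; exact: norm_continuous|exact: closed_le].
have cK := compact_setX (@segment_compact R 0 T) cB.
have /choice[B HB] k : exists B : R, 0 <= B /\ forall p, (`[0, T] `*` [set x : 'rV[R]_d | `|x| <= M])%classic p ->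
    `|'D_(0, delta_mx 0 k) G p| <= B.
  have [|B B0 HB] := @bounded_on_compact R _ ('D_(0, delta_mx 0 k) G) _ cK.
    by apply: continuous_subspaceT; exact: cG.
  by exists B.
exists (\sum_k B k); first by apply: sumr_ge0 => k _; case: (HB k).
move=> s x y sT xM yM; have [th th01 ->] := MVT_space R d G s x y dG.
rewrite mulr_suml (le_trans (ler_norm_sum _ _ _)) //; apply: ler_sum => k _.
rewrite normrM mulrC ler_pM // ?rV_coord_le //; apply: (HB k).2; split => /=.
  by rewrite in_itv.
(* Convexity of the ball keeps the intermediate point where the bounds hold. *)
have -> : x + th *: (y - x) = (1 - th) *: x + th *: y.
  by rewrite scalerBr scalerBl scale1r addrA addrAC.
case/andP: th01 => th0 th1.
rewrite (le_trans (ler_normD _ _)) // !normrZ !ger0_norm ?subr_ge0 //.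
have := normr_ge0 x; have := normr_ge0 y; nra.
Qed.

Lemma slab_lipschitz_rV (R : realType) (d : nat)
    (g : (R * 'rV[R]_d)%type -> 'rV[R]_d) (T M : R) :
  Ck 1 g -> exists2 L : R, 0 <= L & forall (s : R) (x y : 'rV[R]_d),
    0 <= s <= T -> `|x| <= M -> `|y| <= M ->
    `|g (s, y) - g (s, x)| <= L * `|y - x|.
Proof.
move=> g1; have /choice[L HL] j : exists L : R, 0 <= L /\
    forall (s : R) (x y : 'rV[R]_d), 0 <= s <= T -> `|x| <= M -> `|y| <= M ->
    `|g (s, y) 0 j - g (s, x) 0 j| <= L * `|y - x|.
  have [L L0 HL] := slab_lipschitz R d _ T M (Ck1_coord R _ d g j g1).
  by exists L.
have L0 j : 0 <= L j by case: (HL j).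
exists (\sum_j L j); first by apply: sumr_ge0 => j _.
move=> s x y sT xM yM; apply: rV_norm_le; first by rewrite mulr_ge0 ?sumr_ge0.
move=> j; rewrite !mxE; apply: le_trans ((HL j).2 s x y sT xM yM) _.
by rewrite ler_wpM2r // (bigD1 j) //= lerDl sumr_ge0.
Qed.

(** * Gronwall estimate, Lipschitz dependence on labels and the variational equation *)

(** Locating [r] only by its distance to [t] lets [s] lie on either side of [t]. *)
Lemma MVT_within (R : realType) (T : R) (f df : R -> R) (s t : R) :
  (forall r : R, 0 <= r <= T -> is_derive r 1 f (df r)) ->
  0 <= s <= T -> 0 <= t <= T ->
  exists r : R, [/\ 0 <= r <= T, `|r - t| <= `|s - t| & f s - f t = df r * (s - t)].
Proof.
move=> Hf.
have key (a b : R) : 0 <= a <= T -> 0 <= b <= T -> a <= b ->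
    exists2 r : R, a <= r <= b & f b - f a = df r * (b - a).
  move=> /andP[a0 aT] /andP[b0 bT] ab.
  have inT (r : R) : a <= r <= b -> 0 <= r <= T.
    by move=> /andP[ar rb]; rewrite (le_trans a0) // (le_trans rb).
  have [||r + E] := @MVT_segment R f df a b ab.
  - by move=> r; rewrite in_itv /= => /andP[ar rb]; apply/Hf/inT; rewrite !ltW.
  - apply: derivable_within_continuous => r; rewrite in_itv /= => rab.
    by case: (Hf r (inT r rab)).
  - by rewrite in_itv /= => rab; exists r.
move=> sT tT; have [st|/ltW ts] := leP s t.
  have [r /andP[sr rt] E] := key s t sT tT st.
  exists r; split.
  - by case/andP: sT => s0 _; case/andP: tT => _ tT; rewrite (le_trans s0) // (le_trans rt).
  - by rewrite !ler0_norm ?subr_le0 // lerN2 lerD2r.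
  - by rewrite -opprB E -mulrN opprB.
have [r /andP[sr rt] E] := key t s tT sT ts.
exists r; split => //.
- by case/andP: sT => _ sT; case/andP: tT => t0 _; rewrite (le_trans t0) // (le_trans rt).
- by rewrite !ger0_norm ?subr_ge0 // lerD2r.
Qed.

(* The differential inequality is required only where [psi <= 1]: the velocity is
   merely locally Lipschitz. The smallness of [psi 0] keeps [psi] from ever
   reaching 1. *)
Lemma gronwall_below_one (R : realType) (psi dpsi : R -> R) (K T : R) :
  0 <= K -> 0 <= psi 0 ->
  (forall t : R, 0 <= t <= T -> is_derive t 1 psi (dpsi t)) ->
  (forall t : R, 0 <= t <= T -> psi t <= 1 -> dpsi t <= K * psi t) ->
  psi 0 * expR (K * T) < 1 ->
  forall t : R, 0 <= t <= T -> psi t <= psi 0 * expR (K * T).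
Proof.
move=> K0 psi0 dp Hp H1.
(* The bound propagates to [r] as long as [psi] has stayed below 1 before [r]. *)
have A (r : R) : 0 <= r <= T -> (forall s : R, 0 <= s < r -> psi s <= 1) ->
    psi r <= psi 0 * expR (K * T).
  move=> /andP[]; rewrite le_eqVlt => /predU1P[<- T0 _|r0 rT Hr].
    by rewrite ler_peMr // -[1]expR0 ler_expR mulr_ge0.
  suff : psi r * expR (- K * r) <= psi 0.
    rewrite mulNr expRN ler_pdivrMr ?expR_gt0 // => /le_trans; apply.
    by rewrite ler_wpM2l // ler_expR ler_wpM2l.
  (* The integrating factor turns the inequality into a nonpositive derivative, so
     [phi r <= phi 0]. *)
  pose phi (s : R) := psi s * expR (- K * s).
  pose dphi (s : R) := (dpsi s - K * psi s) * expR (- K * s).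
  have dphiE (s : R) : 0 <= s <= T -> is_derive s 1 phi (dphi s).
    move=> /dp dps.
    have dl : is_derive s 1 (fun s : R => - K * s) (- K).
      have -> : (fun s : R => - K * s) = (- K) *: (@id R) by [].
      by apply: is_derive_eq; rewrite /GRing.scale /= mulr1.
    have de := is_derive1_comp (is_derive_expR (- K * s)) dl.
    have -> : phi = psi * (expR \o (fun s : R => - K * s)) by [].
    apply: is_derive_eq.
    by rewrite /dphi /GRing.scale /=; ring.
  have [||c] := @MVT R phi dphi 0 r r0.
  - move=> s; rewrite in_itv /= => /andP[s0 sr]; apply: dphiE.
    by rewrite ltW //= (le_trans (ltW sr)).
  - apply: derivable_within_continuous => s; rewrite in_itv /= => /andP[s0 sr].
    by case: (dphiE s) => //; rewrite s0 (le_trans sr).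
  - rewrite in_itv /= => /andP[c0 cr].
    rewrite {1}/phi {1}/phi mulr0 expR0 mulr1 subr0 => E; rewrite -subr_le0 E.
    rewrite mulr_le0_ge0 // ?(ltW r0) // mulr_le0_ge0 ?expR_ge0 // subr_le0.
    by apply: Hp; [rewrite ltW //= (le_trans (ltW cr))|apply: Hr; rewrite ltW].
suff B (r : R) : 0 <= r <= T -> psi r <= 1.
  by move=> t tT; apply: A => // s /andP[s0 st]; apply: B; rewrite s0 (le_trans (ltW st)) //; case/andP: tT.
move=> rT; rewrite leNgt; apply/negP => psir.
(* At the infimum [m] of the times where [psi] exceeds 1, [A] still applies and gives [psi m < 1];
   by continuity [psi] stays below 1 near [m], whereas points of [S] come arbitrarily close to
   [m]. *)
pose S := [set s : R | 0 <= s <= T /\ 1 < psi s].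
have iS : has_inf S by split; [exists r|exists 0 => s [/andP[]]].
pose m := inf S.
have m0 : 0 <= m by apply: lb_le_inf; [exists r|move=> s [/andP[]]].
have mr : m <= r by apply: inf_lbound; [case: iS|].
have mT : 0 <= m <= T by rewrite m0 (le_trans mr) //; case/andP: rT.
have : psi m < 1.
  apply: le_lt_trans H1; apply: A => // s /andP[s0 sm].
  rewrite leNgt; apply/negP => ps; have := sm; rewrite ltNge => /negP; apply.
  apply: inf_lbound; first by case: iS.
  by split => //; rewrite s0 (le_trans (ltW sm)) //; case/andP: mT.
move=> pm.
have cm := is_derive_continuous _ _ _ _ _ (dp m mT).
have /cvgrPdist_lt /(_ (1 - psi m)) := cm.
rewrite subr_gt0 => /(_ pm) /nbhs_ballP[e /= e0 He].
have [s [sT ps] sme] := inf_adherent e0 iS.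
have ms : m <= s by apply: inf_lbound; [case: iS|].
have := He s; rewrite /ball /= distrC ger0_norm ?subr_ge0 // ltrBlDl => /(_ sme).
by rewrite ltr_norml => /andP[]; lra.
Qed.

(** Gronwall is applied to the sum [psi] of the squared coordinates of the difference of two
    trajectories: unlike the maximum norm it is differentiable, and it is comparable to the square
    of that norm up to the factor [d]. *)
Lemma flow_lipschitz (R : realType) (d : nat) (T : R)
    (g : (R * 'rV[R]_d)%type -> 'rV[R]_d) (X : R -> 'rV[R]_d -> 'rV[R]_d) :
  0 < T -> Ck 1 g ->
  (forall a, X 0 a = a /\
    forall t : R, 0 <= t <= T -> is_ddt T (fun s => X s a) t (g (t, X t a))) ->
  forall a, exists C r : R, [/\ 0 < C, 0 < r & forall b, `|b - a| < r ->
    forall s : R, 0 <= s <= T -> `|X s b - X s a| <= C * `|b - a|].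
Proof.
move=> T0 g1 HX a.
have ext b := is_ddt_extend _ _ _ _ _ T0 (HX b).2.
have [Fa [FaE dFa]] := ext a.
have T00 : 0 <= (0 : R) <= T by rewrite lexx ltW.
have [M M0 HM] : exists2 M : R, 0 <= M & forall s : R, 0 <= s <= T -> `|X s a| <= M.
  have [||M M0 HM] := @bounded_on_compact R _ (fun s => `|Fa s|) `[0, T].
  - exact: segment_compact.
  - apply: continuous_in_subspaceT => s; rewrite inE /= in_itv /= => sT.
    apply: (@continuous_comp _ _ _ Fa Num.norm); last exact: norm_continuous.
    exact: is_derive_continuous (dFa s sT).
  exists M => // s sT; rewrite -FaE //.
  by have := HM s; rewrite /= in_itv /= normr_id => /(_ sT).
(* The extra unit of radius contains the second trajectory whenever [psi <= 1]. *)
have [L L0 HL] := slab_lipschitz_rV R d g T (M + 1) g1.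
pose K := 2 * d%:R * L.
have K0 : 0 <= K by rewrite !mulr_ge0.
pose E := d%:R * expR (K * T).
have E0 : 0 <= E by rewrite mulr_ge0 // expR_ge0.
(* [E * |b - a|^2] will bound [psi]. The constant [1 + E] is positive and its square dominates [E];
   the radius makes the Gronwall bound smaller than 1. *)
exists (1 + E), (1 + E)^-1; split; rewrite ?invr_gt0 ?ltr_pwDl // => b ba s sT.
have [Fb [FbE dFb]] := ext b.
pose z (s : R) := Fb s - Fa s.
pose psi (s : R) := \sum_j z s 0 j ^+ 2.
pose dpsi (s : R) := \sum_j 2 * z s 0 j * (g (s, X s b) - g (s, X s a)) 0 j.
have zpsi (t : R) : `|z t| ^+ 2 <= psi t.
  have pt : 0 <= psi t by apply: sumr_ge0 => j _; exact: sqr_ge0.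
  rewrite -(sqr_sqrtr pt) lerXn2r ?nnegrE ?sqrtr_ge0 //.
  apply: rV_norm_le => [|j]; first exact: sqrtr_ge0.
  rewrite -sqrtr_sqr ler_sqrt // /psi (bigD1 j) //= lerDl.
  by apply: sumr_ge0 => k _; exact: sqr_ge0.
have psiz (t : R) : psi t <= d%:R * `|z t| ^+ 2.
  apply: (@le_trans _ _ (\sum_(j < d) `|z t| ^+ 2)).
    apply: ler_sum => j _; rewrite -real_normK ?num_real //.
    by rewrite lerXn2r ?nnegrE // rV_coord_le.
  by rewrite sumr_const card_ord mulr_natl.
have dz (t : R) j : 0 <= t <= T -> is_derive t 1 (fun s => z s 0 j) ((g (t, X t b) - g (t, X t a)) 0 j).
  move=> tT; have dza := dFa t tT; have dzb := dFb t tT.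
  by apply: is_derive_coord; exact: is_deriveB.
have dp (t : R) : 0 <= t <= T -> is_derive t 1 psi (dpsi t).
  move=> tT.
  have -> : psi = \sum_j (fun s => z s 0 j ^+ 2).
    by apply/funext => t'; rewrite /psi fct_sumE.
  apply: is_derive_sum => j; have dzj := dz t j tT.
  apply: is_derive_eq; rewrite /GRing.scale /=; ring.
have z0 : z 0 = b - a by rewrite /z FaE // FbE // (HX a).1 (HX b).1.
have psi0 : psi 0 * expR (K * T) <= E * `|b - a| ^+ 2.
  by rewrite /E [leRHS]mulrAC; apply: ler_wpM2r; rewrite ?expR_ge0 // -z0 psiz.
have psi_ge0 : 0 <= psi 0 by rewrite (le_trans _ (zpsi 0)) // sqr_ge0.
have E1 : (1 + E) * `|b - a| < 1 by rewrite mulrC -ltr_pdivlMr ?div1r // ltr_pwDl.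
have G : psi s <= psi 0 * expR (K * T).
  apply: (gronwall_below_one R psi dpsi) => //.
    move=> t tT pt.
    have zt1 : `|z t| <= 1.
      have := le_trans (zpsi t) pt; have := normr_ge0 (z t); nra.
    have zE : z t = X t b - X t a by rewrite /z FaE // FbE.
    have XaM := HM t tT.
    have HLt := HL t (X t a) (X t b) tT.
    have {}HLt : `|g (t, X t b) - g (t, X t a)| <= L * `|z t|.
      rewrite zE; apply: HLt; first by rewrite (le_trans XaM) // lerDl.
      rewrite -(subrK (X t a) (X t b)) -zE addrC (le_trans (ler_normD _ _)) //.
      exact: lerD.
    apply: (@le_trans _ _ (\sum_(j < d) 2 * L * psi t)).
      apply: ler_sum => j _.
      apply: (@le_trans _ _ (2 * L * `|z t| ^+ 2)).
        rewrite -!mulrA ler_wpM2l // (le_trans (ler_norm _)) // normrM.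
        rewrite expr2 mulrCA; apply: ler_pM => //; first exact: rV_coord_le.
        by apply: le_trans (rV_coord_le R d _ _) _.
      by rewrite ler_wpM2l // mulr_ge0.
    by rewrite sumr_const card_ord -mulr_natl /K le_eqVlt; apply/orP; left; apply/eqP; ring.
  apply: le_lt_trans psi0 _.
  have := normr_ge0 (b - a); nra.
have : `|z s| ^+ 2 <= ((1 + E) * `|b - a|) ^+ 2.
  rewrite (le_trans (zpsi s)) // (le_trans G) // (le_trans psi0) // exprMn.
  rewrite ler_wpM2r ?sqr_ge0 //; nra.
rewrite ler_pXn2r ?nnegrE // ?mulr_ge0 ?addr_ge0 //.
by rewrite /z FaE // FbE.
Qed.

(* In the limit h -> 0 the time difference quotient of
   (X s (a + h v) - X s a) / h is compared with the right-hand side, after one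
   mean value theorem in time and one in space. *)
Lemma flow_derive_is_ddt (R : realType) (d : nat) (T : R)
    (g : (R * 'rV[R]_d)%type -> 'rV[R]_d) (X : R -> 'rV[R]_d -> 'rV[R]_d)
    (a v : 'rV[R]_d) (k : 'I_d) (t : R) :
  0 < T -> Ck 1 g ->
  (forall a, X 0 a = a /\
    forall t : R, 0 <= t <= T -> is_ddt T (fun s => X s a) t (g (t, X t a))) ->
  (forall t : R, 0 <= t <= T -> differentiable (X t) a) ->
  0 <= t <= T ->
  is_ddt T (fun s => 'D_v (fun x => X s x 0 k) a) t
    (\sum_l 'D_v (fun x => X t x 0 l) a
       * 'D_(0, delta_mx 0 l) (fun p => g p 0 k) (t, X t a)).
Proof.
move=> T0 g1 HX dX tT.
have ext b := is_ddt_extend _ _ _ _ _ T0 (HX b).2.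
have [Fa [FaE dFa]] := ext a.
have gk1 := Ck1_coord R _ d g k g1.
pose D l p := 'D_(0, delta_mx 0 l) (fun p => g p 0 k) p.
pose p0 := (t, X t a).
have [C [r0 [C0 r00 HC]]] := flow_lipschitz R d T g X T0 g1 HX a.
pose N := `|v| + 1.
have N0 : 0 < N by rewrite ltr_wpDl.
(* One unit allows for the drift of [X r a] away from [X t a], the other for the perturbation
   [z r h]. *)
pose M := `|X t a| + 2.
have [L L0 HL] := slab_lipschitz_rV R d g T M g1.
pose S := \sum_l `|D l p0|.
have S0 : 0 <= S by apply: sumr_ge0.
have DS l : `|D l p0| <= S by rewrite /S (bigD1 l) //= lerDl sumr_ge0.
apply/is_ddtP => e e0.
(* Each of the [d] coordinates will contribute at most [2 * eta * C * N * |h|], so the total stays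
   below [e * |h|]. *)
pose eta := e / (2 * (d%:R + 1) * C * N).
have eta0 : 0 < eta by rewrite divr_gt0 // !mulr_gt0 // ltr_wpDl.
have [d1 d10 Hd1] : exists2 d1 : R, 0 < d1 & forall (r : R) (x : 'rV[R]_d),
    `|r - t| < d1 -> `|x - X t a| < d1 -> forall l, `|D l (r, x) - D l p0| <= eta.
  have : \forall p \near p0, forall l, `|D l p - D l p0| <= eta.
    apply: (@filter_forall _ _ (fun l p => `|D l p - D l p0| <= eta) (nbhs p0) _) => l.
    have /cvgrPdist_le /(_ eta eta0) := gk1.2 (0, delta_mx 0 l) p0.
    by apply: filterS => p; rewrite distrC.
  move=> /nbhs_ballP[d1 /= d10 H]; exists d1 => // r x rt xt l.
  by apply: H; split; rewrite /= -ball_normE /ball_ /= distrC.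
(* Half of [d1'] goes to the motion of [X r a] in time, half to the perturbation [z r h], keeping
   the intermediate points within [d1] of [X t a]. *)
pose d1' := Num.min d1 1.
have d1'0 : 0 < d1' by rewrite lt_min d10 ltr01.
have [d2 d20 Hd2] : exists2 d2 : R, 0 < d2 & forall r : R, 0 <= r <= T ->
    `|r - t| < d2 -> `|X r a - X t a| < d1' / 2.
  have cFa := is_derive_continuous _ _ _ _ _ (dFa t tT).
  have /cvgrPdist_lt /(_ (d1' / 2)) := cFa.
  rewrite divr_gt0 // => /(_ isT) /nbhs_ballP[d2 /= d20 H]; exists d2 => // r rT rt.
  by have := H r; rewrite /ball /= (FaE t) // (FaE r) // distrC => /(_ rt); rewrite distrC.
(* This bounds by [eta] the factor [L * S * |r - t|] caused by the motion of [z] between [t] and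
   [r]. *)
pose d3 := eta / (L * S + 1).
have LS1 : 0 < L * S + 1 by rewrite ltr_wpDl // mulr_ge0.
have d30 : 0 < d3 by rewrite divr_gt0.
exists (Num.min d1' (Num.min d2 d3)); first by rewrite lt_min d1'0 lt_min d20.
move=> s sT; rewrite lt_min => /andP[st1]; rewrite lt_min => /andP[st2 st3] snt.
have stn0 : s - t != 0 by rewrite subr_eq0.
pose z (r h : R) := X r (h *: v + a) - X r a.
(* As h tends to 0, [q h] tends to the error to be estimated, and a bound by [e] passes to the
   limit. The admissible [s] were fixed before [h], so nothing depends on the rate of
   convergence. *)
pose q (h : R) := \sum_l (h^-1 *: z t h 0 l) * D l p0
   - (s - t)^-1 *: (h^-1 *: z s h 0 k - h^-1 *: z t h 0 k).
have cz (r : R) l : 0 <= r <= T ->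
    (h^-1 *: z r h 0 l) @[h --> 0^'] --> 'D_v (fun x => X r x 0 l) a.
  move=> rT.
  have dXl : derivable (fun x => X r x 0 l) a v.
    apply: (derivable_mxP (X r) a v).1; exact: diff_derivable (dX r rT).
  apply: cvg_trans dXl; apply: near_eq_cvg; near=> h.
  by rewrite /z !mxE.
have cq : q h @[h --> 0^'] --> \sum_l 'D_v (fun x => X t x 0 l) a * D l p0
   - time_quotient (fun s => 'D_v (fun x => X s x 0 k) a) t s.
  apply: cvgB; last by apply: cvgZl_tmp; apply: cvgB; apply: cz.
  by apply: cvg_big => [|l _]; [exact: add_continuous|]; apply: cvgMr_tmp; apply: cz.
suff qe : \forall h \near 0^', `|q h| <= e.
  exact: (cvgr_to_le (cvg_norm cq)).
near=> h.
have h0 : h != 0 by near: h; exact: nbhs_dnbhs_neq.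
have nh0 : 0 < `|h| by rewrite normr_gt0.
pose b := h *: v + a.
have bah : `|b - a| <= `|h| * N.
  by rewrite /b addrK normrZ ler_wpM2l // lerDl.
have hr0 : `|h| * N < r0.
  rewrite -ltr_pdivlMr //; near: h; apply: dnbhs0_lt; exact: divr_gt0.
have hC : C * (`|h| * N) < d1' / 2.
  rewrite mulrCA -ltr_pdivlMr ?mulr_gt0 //; near: h; apply: dnbhs0_lt.
  by rewrite !divr_gt0 // mulr_gt0.
have zle (r : R) : 0 <= r <= T -> `|z r h| <= C * (`|h| * N).
  move=> rT; apply: le_trans (HC b (le_lt_trans bah hr0) r rT) _.
  by rewrite ler_wpM2l // ltW.
have [Fb [FbE dFb]] := ext b.
have dz (r : R) l : 0 <= r <= T -> is_derive r 1 (fun s => (Fb s - Fa s) 0 l) ((g (r, X r b) - g (r, X r a)) 0 l).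
  move=> rT; have dza := dFa r rT; have dzb := dFb r rT.
  by apply: is_derive_coord; exact: is_deriveB.
have zE (r : R) : 0 <= r <= T -> Fb r - Fa r = z r h by move=> rT; rewrite FbE // FaE.
have d1'1 : d1' <= 1 by rewrite ge_min lexx orbT.
have d1'd1 : d1' <= d1 by rewrite ge_min lexx.
have Xbnd (r : R) : 0 <= r <= T -> `|r - t| <= `|s - t| -> `|X r a| <= M /\ `|X r b| <= M.
  move=> rT rt; have := Hd2 r rT (le_lt_trans rt st2) => Xr.
  have z1 := zle r rT.
  have E : `|X r a| <= `|X t a| + 1.
    rewrite -(subrK (X t a) (X r a)) addrC (le_trans (ler_normD _ _)) // lerD2l.
    lra.
  split; first by rewrite (le_trans E) // /M; lra.
  rewrite (_ : X r b = X r a + z r h); last by rewrite /z addrC subrK.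
  rewrite (le_trans (ler_normD _ _)) // /M; lra.
have [r [rT rt zr]] := MVT_within R T _ _ s t (fun r rT => dz r k rT) sT tT.
rewrite /= !zE // in zr.
have [th th01 gr] := MVT_space R d (fun p => g p 0 k) r (X r a) (X r b) gk1.1.
(* A second mean value theorem in time: the velocity of [z] is at most [L] times its size. *)
have zlt l : `|(z r h - z t h) 0 l| <= `|r - t| * (L * (C * (`|h| * N))).
  have [r' [rT' rt' zr']] := MVT_within R T _ _ r t (fun r rT => dz r l rT) rT tT.
  rewrite /= !zE // in zr'.
  rewrite !mxE in zr' *; rewrite zr' normrM mulrC ler_wpM2l //.
  have [Xa Xb] := Xbnd r' rT' (le_trans rt' rt).
  have := HL r' (X r' a) (X r' b) rT' Xa Xb.
  have := rV_coord_le R d (g (r', X r' b) - g (r', X r' a)) l; rewrite !mxE => H1 H2.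
  rewrite (le_trans H1) // (le_trans H2) // ler_wpM2l //; exact: zle.
pose xi := X r a + th *: (X r b - X r a).
have Dxi l : `|D l (r, xi) - D l p0| <= eta.
  apply: Hd1; first by rewrite (le_lt_trans rt) // (lt_le_trans st1).
  rewrite /xi addrAC (le_lt_trans (ler_normD _ _)) // normrZ.
  have := Hd2 r rT (le_lt_trans rt st2); have := zle r rT; rewrite -/(z r h).
  case/andP: th01 => th0 th1; rewrite (ger0_norm th0).
  have := normr_ge0 (z r h); rewrite {1 2 3}/z -/b; nra.
have qE : q h = h^-1 * \sum_l (z t h 0 l * D l p0 - z r h 0 l * D l (r, xi)).
  rewrite /q -[_ *: _ - _]scalerBr zr scalerA mulrC -scalerA /GRing.scale /=.
  rewrite sumrB [RHS]mulrBr; congr (_ - _).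
    by rewrite mulr_sumr; apply: eq_bigr => l _; rewrite mulrA.
  congr (_ * _); rewrite [_ * (s - t)]mulrC mulKf //.
  by move: gr; rewrite !mxE.
rewrite qE normrM normfV ler_pdivrMl //.
apply: le_trans (ler_norm_sum _ _ _) _.
apply: (@le_trans _ _ (\sum_(l < d) C * (`|h| * N) * (2 * eta))).
  apply: ler_sum => l _.
  (* The error splits into the variation of the velocity gradient, controlled by [Dxi], and the
     variation of [z] in time, controlled by [zlt]. *)
  have -> : z t h 0 l * D l p0 - z r h 0 l * D l (r, xi) =
     - (z r h 0 l * (D l (r, xi) - D l p0) + (z r h - z t h) 0 l * D l p0).
    by rewrite !mxE; ring.
  rewrite normrN (le_trans (ler_normD _ _)) // !normrM.
  have zrl : `|z r h 0 l| <= C * (`|h| * N).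
    by apply: le_trans (rV_coord_le R d _ _) _; exact: zle.
  have P0 : 0 <= C * (`|h| * N) by rewrite !mulr_ge0 // ltW.
  have H1 : `|z r h 0 l| * `|D l (r, xi) - D l p0| <= C * (`|h| * N) * eta.
    by rewrite ler_pM.
  have H2 : `|(z r h - z t h) 0 l| * `|D l p0| <= C * (`|h| * N) * eta.
    apply: (@le_trans _ _ (`|r - t| * (L * (C * (`|h| * N))) * S)).
      by rewrite ler_pM.
    have : `|r - t| * (L * S + 1) <= eta.
      by rewrite -ler_pdivlMr // (le_trans rt) // ltW.
    have := normr_ge0 (r - t); have := P0; move: (C * _) => P.
    move: (`|r - t|) => w; nra.
  lra.
rewrite sumr_const card_ord -[leLHS]mulr_natl /eta.
have dD : 0 < d%:R + 1 :> R by rewrite ltr_wpDl.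
apply: (@le_trans _ _ (`|h| * e * (d%:R / (d%:R + 1)))).
  by rewrite le_eqVlt; apply/orP; left; apply/eqP; field; rewrite !gt_eqF.
by rewrite ler_piMr ?mulr_ge0 ?(ltW e0) // ler_pdivrMr // mul1r lerDl.
Unshelve. all: by end_near.
Qed.

(** * The two equations along a trajectory *)

Definition material_derivative (R : realType) (d : nat) (G : (R * 'rV[R]_d)%type -> R)
    (v : 'rV[R]_d) (p : (R * 'rV[R]_d)%type) : R :=
  'D_(1, 0) G p + \sum_i v 0 i * 'D_(0, delta_mx 0 i) G p.

Definition divergence (R : realType) (d : nat)
    (g : (R * 'rV[R]_d)%type -> 'rV[R]_d) (p : (R * 'rV[R]_d)%type) : R :=
  \sum_i 'D_(0, delta_mx 0 i) (fun p => g p 0 i) p.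

(** Meant for extensions [r] and [g] of the density and velocity to all times, so that ordinary
    two-sided derivatives can be used. *)
Definition mass_residual (R : realType) (d : nat) (r : (R * 'rV[R]_d)%type -> R)
    (g : (R * 'rV[R]_d)%type -> 'rV[R]_d) (p : (R * 'rV[R]_d)%type) : R :=
  material_derivative R d r (g p) p + r p * divergence R d g p.

Definition momentum_residual (R : realType) (d : nat)
    (eta : (R * 'rV[R]_d)%type -> R) (g : (R * 'rV[R]_d)%type -> 'rV[R]_d)
    (k : 'I_d) (p : (R * 'rV[R]_d)%type) : R :=
  material_derivative R d (fun p => g p 0 k) (g p) p + 'D_(0, delta_mx 0 k) eta p.

(* The function under the gradient in the velocity formula, [eta] standing for
   [h (rho)]. *)
Definition weber_potential (R : realType) (d : nat)
    (eta : (R * 'rV[R]_d)%type -> R) (g : (R * 'rV[R]_d)%type -> 'rV[R]_d)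
    (p : (R * 'rV[R]_d)%type) : R :=
  eta p - 2^-1 * sqnorm (g p).

(** The time derivative of [r] along the trajectory is its material derivative; adding the integrand
    gives exactly the mass residual, so [integral_eq_iff_derive_eq] applies. *)
Lemma lagrangian_density_equiv (R : realType) (d : nat) (T : R)
    (r : (R * 'rV[R]_d)%type -> R) (g : (R * 'rV[R]_d)%type -> 'rV[R]_d)
    (X : R -> 'rV[R]_d -> 'rV[R]_d) (a : 'rV[R]_d) (r0 : R) :
  0 < T -> Ck 1 r -> Ck 1 g -> X 0 a = a ->
  (forall t : R, 0 <= t <= T -> is_ddt T (fun s => X s a) t (g (t, X t a))) ->
  (forall t : R, 0 <= t <= T -> r (t, X t a) - r0
     + \int[lebesgue_measure]_(s in `[0, t])
         (r (s, X s a) * divergence R d g (s, X s a)) = 0) <->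
  (r (0, a) = r0 /\
   forall t : R, 0 <= t <= T -> mass_residual R d r g (t, X t a) = 0).
Proof.
move=> T0 r1 g1 X0 HX; have [c [cE dc]] := is_ddt_extend _ _ _ _ _ T0 HX.
have T00 : 0 <= (0 : R) <= T by rewrite lexx ltW.
have cc (t : R) : 0 <= t <= T -> {for t, continuous (fun s => (s, c s))}.
  move=> tT; have [/derivable1_diffP dct _] := dc t tT.
  by apply: differentiable_continuous; exact: differentiable_pair.
pose q (s : R) := r (s, c s) * divergence R d g (s, c s).
have cq (t : R) : 0 <= t <= T -> {for t, continuous q}.
  move=> tT; apply: continuousM.
    apply: (@continuous_comp _ _ _ (fun s => (s, c s)) r); first exact: cc.
    exact/differentiable_continuous/r1.1.
  apply: (@continuous_comp _ _ _ (fun s => (s, c s)) (divergence R d g)); first exact: cc.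
  apply: cvg_big => [|i _]; first exact: add_continuous.
  exact: (Ck1_coord R _ d g i g1).2.
have df (t : R) : 0 <= t <= T -> is_derive t 1 (fun s => r (s, c s))
    (material_derivative R d r (g (t, c t)) (t, c t)).
  move=> tT; have dct := dc t tT; rewrite -cE // in dct.
  apply: is_derive_eq.
    by apply: (is_derive_time_space R d r id c); exact: r1.1.
  by rewrite mul1r.
have IE (t : R) : 0 <= t <= T -> \int[lebesgue_measure]_(s in `[0, t]) q s =
    \int[lebesgue_measure]_(s in `[0, t]) (r (s, X s a) * divergence R d g (s, X s a)).
  move=> /andP[t0 tT]; apply: eq_Rintegral => s.
  rewrite inE /= in_itv /= => /andP[s0 st].
  by rewrite /q cE // s0 (le_trans st).
have [E1 E2] := integral_eq_iff_derive_eq R T _ _ q r0 T0 df cq.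
split=> [H|[H1 H2] t tT].
  have [|H1 H2] := E1.
    by move=> t tT; have := H t tT; rewrite -IE // -(cE t tT).
  split; first by rewrite -H1 (cE 0) // X0.
  by move=> t tT; have := H2 t tT; rewrite /q (cE t tT).
rewrite -IE // -(cE t tT); apply: E2 => //.
split; first by rewrite (cE 0) // X0.
by move=> t' tT'; have := H2 t' tT'; rewrite -(cE t' tT').
Qed.

Lemma weber_potentialE (R : realType) (d : nat)
    (eta : (R * 'rV[R]_d)%type -> R) (g : (R * 'rV[R]_d)%type -> 'rV[R]_d) :
  weber_potential R d eta g = eta - 2^-1 *: \sum_l (fun p => g p 0 l) ^+ 2.
Proof.
apply/funext => p.
rewrite [RHS]/(eta p - 2^-1 * ((\sum_l (fun p => g p 0 l) ^+ 2) p)) fct_sumE.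
by congr (_ - _ * _); apply: eq_bigr => l _.
Qed.

Lemma weber_potential_differentiable (R : realType) (d : nat)
    (eta : (R * 'rV[R]_d)%type -> R) (g : (R * 'rV[R]_d)%type -> 'rV[R]_d) p :
  Ck 1 eta -> Ck 1 g -> differentiable (weber_potential R d eta g) p.
Proof.
move=> [de _] g1; rewrite weber_potentialE; apply: differentiableB => //.
apply: differentiableZ; apply: differentiable_sum => l; apply: differentiableX.
exact: (Ck1_coord R _ d g l g1).1.
Qed.

Lemma derive_weber_potential (R : realType) (d : nat)
    (eta : (R * 'rV[R]_d)%type -> R) (g : (R * 'rV[R]_d)%type -> 'rV[R]_d) p w :
  Ck 1 eta -> Ck 1 g -> 'D_w (weber_potential R d eta g) p =
    'D_w eta p - \sum_l g p 0 l * 'D_w (fun p => g p 0 l) p.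
Proof.
move=> [de _] g1; rewrite weber_potentialE.
have dg l : is_derive p w (fun p => g p 0 l) ('D_w (fun p => g p 0 l) p).
  by apply/derivableP/diff_derivable/(Ck1_coord R _ d g l g1).1.
have dee : is_derive p w eta ('D_w eta p) by apply/derivableP/diff_derivable.
rewrite derive_val; congr (_ - _); rewrite scaler_sumr; apply: eq_bigr => l _.
by rewrite /GRing.scale /= ?expr1; field.
Qed.

(** The flow gradient is differentiable in time only within [[0, T]]. Extending it and the
    trajectory beyond the endpoints gives an integrand continuous at every time of [[0, T]], hence
    integrable there. *)
Lemma weber_integrand_extend (R : realType) (d : nat) (T : R)
    (eta : (R * 'rV[R]_d)%type -> R) (g : (R * 'rV[R]_d)%type -> 'rV[R]_d)
    (X : R -> 'rV[R]_d -> 'rV[R]_d) (a : 'rV[R]_d) (j : 'I_d) :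
  0 < T -> Ck 1 eta -> Ck 1 g ->
  (forall a, X 0 a = a /\
    forall t : R, 0 <= t <= T -> is_ddt T (fun s => X s a) t (g (t, X t a))) ->
  (forall t : R, 0 <= t <= T -> differentiable (X t) a) ->
  exists q : R -> R, (forall s : R, 0 <= s <= T -> q s =
      \sum_k 'D_(delta_mx 0 j) (fun x => X s x 0 k) a
        * 'D_(0, delta_mx 0 k) (weber_potential R d eta g) (s, X s a)) /\
    forall t : R, 0 <= t <= T -> {for t, continuous q}.
Proof.
move=> T0 e1 g1 HX dX; pose Y s k := 'D_(delta_mx 0 j) (fun x => X s x 0 k) a.
have [X0 HXa] := HX a; have [c [cE dc]] := is_ddt_extend _ _ _ _ _ T0 HXa.
pose dY (t : R) k := \sum_l Y t l * 'D_(0, delta_mx 0 l) (fun p => g p 0 k) (t, X t a).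
have /choice[y Hy] k : exists y : R -> R, (forall s : R, 0 <= s <= T -> y s = Y s k) /\
    forall t : R, 0 <= t <= T -> is_derive t 1 y (dY t k).
  apply: (is_ddt_extend R R T (fun s => Y s k) (fun t => dY t k) T0) => t tT.
  exact: flow_derive_is_ddt.
have yE k (s : R) : 0 <= s <= T -> y k s = Y s k by exact: (Hy k).1.
have dy k (s : R) : 0 <= s <= T -> is_derive s 1 (y k) (dY s k) by exact: (Hy k).2.
have cc (t : R) : 0 <= t <= T -> {for t, continuous (fun s => (s, c s))}.
  move=> tT; have [/derivable1_diffP dct _] := dc t tT.
  by apply: differentiable_continuous; exact: differentiable_pair.
have gk k := Ck1_coord R _ d g k g1.
pose H := weber_potential R d eta g.
(* The explicit formula involves only [g] and first derivatives of [eta] and [g], all continuous. *)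
have cDH k : continuous ('D_(0, delta_mx 0 k) H).
  rewrite (_ : 'D_(0, delta_mx 0 k) H = fun p => 'D_(0, delta_mx 0 k) eta p
      - \sum_l g p 0 l * 'D_(0, delta_mx 0 k) (fun p => g p 0 l) p); last first.
    by apply/funext => p; exact: derive_weber_potential.
  move=> p; apply: cvgB; first exact: e1.2.
  apply: cvg_big => [|l _]; first exact: add_continuous.
  apply: cvgM; first exact/differentiable_continuous/(gk l).1.
  exact: (gk l).2.
pose q (s : R) := \sum_k y k s * 'D_(0, delta_mx 0 k) H (s, c s).
have cq (t : R) : 0 <= t <= T -> {for t, continuous q}.
  move=> tT; apply: cvg_big => [|k _]; first exact: add_continuous.
  apply: cvgM; first exact: is_derive_continuous (dy k t tT).
  by apply: (@continuous_comp _ _ _ (fun s => (s, c s)) ('D_(0, delta_mx 0 k) H)); [exact: cc|exact: cDH].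
exists q; split => // s sT.
by rewrite /q cE //; apply: eq_bigr => k _; rewrite yE.
Qed.

(** In the derivative of the sum of [g_k * Y_k], the variational equation produces the label
    gradient of half the squared speed. The kinetic part of the Weber potential cancels it, leaving
    [Y] applied to the momentum residual. *)
Lemma lagrangian_velocity_equiv (R : realType) (d : nat) (T : R)
    (eta : (R * 'rV[R]_d)%type -> R) (g : (R * 'rV[R]_d)%type -> 'rV[R]_d)
    (X : R -> 'rV[R]_d -> 'rV[R]_d) (a : 'rV[R]_d) (j : 'I_d) (w0 : R) :
  0 < T -> Ck 1 eta -> Ck 1 g ->
  (forall a, X 0 a = a /\
    forall t : R, 0 <= t <= T -> is_ddt T (fun s => X s a) t (g (t, X t a))) ->
  (forall t : R, 0 <= t <= T -> differentiable (X t) a) ->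
  let Y s k := 'D_(delta_mx 0 j) (fun x => X s x 0 k) a in
  (forall t : R, 0 <= t <= T -> \sum_k g (t, X t a) 0 k * Y t k - w0
     + \int[lebesgue_measure]_(s in `[0, t])
         (\sum_k Y s k * 'D_(0, delta_mx 0 k) (weber_potential R d eta g) (s, X s a)) = 0) <->
  (g (0, a) 0 j = w0 /\ forall t : R, 0 <= t <= T ->
     \sum_k Y t k * momentum_residual R d eta g k (t, X t a) = 0).
Proof.
move=> T0 e1 g1 HX dX Y.
have [X0 HXa] := HX a; have [c [cE dc]] := is_ddt_extend _ _ _ _ _ T0 HXa.
have T00 : 0 <= (0 : R) <= T by rewrite lexx ltW.
pose dY (t : R) k := \sum_l Y t l * 'D_(0, delta_mx 0 l) (fun p => g p 0 k) (t, X t a).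
have /choice[y Hy] k : exists y : R -> R, (forall s : R, 0 <= s <= T -> y s = Y s k) /\
    forall t : R, 0 <= t <= T -> is_derive t 1 y (dY t k).
  apply: (is_ddt_extend R R T (fun s => Y s k) (fun t => dY t k) T0) => t tT.
  exact: flow_derive_is_ddt.
have yE k (s : R) : 0 <= s <= T -> y k s = Y s k by exact: (Hy k).1.
have dy k (s : R) : 0 <= s <= T -> is_derive s 1 (y k) (dY s k) by exact: (Hy k).2.
have gk k := Ck1_coord R _ d g k g1.
have [q [qE cq]] := weber_integrand_extend R d T eta g X a j T0 e1 g1 HX dX.
pose f (s : R) := \sum_k g (s, c s) 0 k * y k s.
pose df (t : R) := \sum_k (g (t, c t) 0 k * dY t k
  + y k t * material_derivative R d (fun p => g p 0 k) (g (t, c t)) (t, c t)).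
have dfE (t : R) : 0 <= t <= T -> is_derive t 1 f (df t).
  move=> tT; have dct := dc t tT; rewrite -cE // in dct.
  have -> : f = \sum_k ((fun s => g (s, c s) 0 k) * y k).
    by apply/funext => s; rewrite /f fct_sumE.
  apply: is_derive_sum => k; have dyk := dy k t tT.
  have dgk : is_derive t 1 (fun s => g (s, c s) 0 k)
      (material_derivative R d (fun p => g p 0 k) (g (t, c t)) (t, c t)).
    apply: is_derive_eq.
      by apply: (is_derive_time_space R d (fun p => g p 0 k) id c); exact: (gk k).1.
    by rewrite mul1r.
  exact: is_deriveM.
have IE (t : R) : 0 <= t <= T -> \int[lebesgue_measure]_(s in `[0, t]) q s =
    \int[lebesgue_measure]_(s in `[0, t])
      (\sum_k Y s k * 'D_(0, delta_mx 0 k) (weber_potential R d eta g) (s, X s a)).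
  move=> /andP[t0 tT]; apply: eq_Rintegral => s.
  rewrite inE /= in_itv /= => /andP[s0 st].
  have sT : 0 <= s <= T by rewrite s0 (le_trans st).
  exact: qE.
have fE (t : R) : 0 <= t <= T -> f t = \sum_k g (t, X t a) 0 k * Y t k.
  by move=> tT; rewrite /f cE //; apply: eq_bigr => k _; rewrite yE.
(* Since [X 0] is the identity, [Y 0] is the Kronecker delta. *)
have f0 : f 0 = g (0, a) 0 j.
  rewrite fE // X0 (bigD1 j) //= big1 ?addr0 => [|k kj]; rewrite /Y.
    rewrite (derive_id_coord R d (X 0) 0) ?eqxx ?mulr1 // => b.
    by rewrite addr0; case: (HX b).
  rewrite (derive_id_coord R d (X 0) 0) 1?eq_sym ?(negbTE kj) ?mulr0 // => b.
  by rewrite addr0; case: (HX b).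
have dfq (t : R) : 0 <= t <= T -> df t + q t =
    \sum_k Y t k * momentum_residual R d eta g k (t, X t a).
  move=> tT; rewrite /df qE // cE // big_split /= -addrA -big_split /=.
  rewrite /dY.
  under eq_bigr do rewrite mulr_sumr.
  (* After the exchange, the [g dY] term is indexed by the component of [Y], which lines it up with
     the kinetic term. *)
  rewrite exchange_big /= -big_split /=; apply: eq_bigr => k _.
  rewrite yE // /momentum_residual derive_weber_potential //.
  set M := material_derivative _ _ _ _ _.
  set S := (X in Y t k * (_ - X)); set S' := (X in X + _ = _).
  have -> : S' = Y t k * S.
    by rewrite /S mulr_sumr; apply: eq_bigr => l _; rewrite mulrCA.
  ring.
have [E1 E2] := integral_eq_iff_derive_eq R T _ _ q w0 T0 dfE cq.
split=> [K|[H1 H2] t tT].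
  have [|H1 H2] := E1.
    by move=> t tT; have := K t tT; rewrite -IE // -fE.
  split; first by rewrite -H1.
  by move=> t tT; rewrite -dfq // H2.
rewrite -IE // -fE //; apply: E2 => //.
split; first by rewrite f0.
by move=> t' tT'; rewrite dfq // H2.
Qed.

(** * Tools for passing between labels and positions *)

Lemma left_inverse_mx_eq0 (R : realType) (d : nat) (M N : 'M[R]_d) (w : 'I_d -> R) :
  M *m N = 1%:M -> (forall i, \sum_j N i j * w j = 0) -> forall j, w j = 0.
Proof.
move=> MN Nw j; pose W := \col_k w k.
have NW : N *m W = 0.
  by apply/colP => i; rewrite !mxE -[RHS](Nw i); apply: eq_bigr => k _; rewrite mxE.
have : M *m N *m W = 0 by rewrite -mulmxA NW mulmx0.
by rewrite MN mul1mx => /colP /(_ j); rewrite !mxE.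
Qed.

(** At every time of [[0, T]], endpoints included, the derivative within [[0, T]] equals the
    two-sided derivative of the extension; the spatial derivatives agree because the functions
    coincide on the whole time slice. *)
Lemma euler_system_residuals (R : realType) (d : nat) (T : R) (h : R -> R)
    (rho : R -> 'rV[R]_d -> R) (u : R -> 'rV[R]_d -> 'rV[R]_d)
    (r eta : (R * 'rV[R]_d)%type -> R) (g : (R * 'rV[R]_d)%type -> 'rV[R]_d) :
  0 < T -> Ck 1 r -> Ck 1 g ->
  (forall (t : R) x, 0 <= t <= T -> rho t x = r (t, x)) ->
  (forall (t : R) x, 0 <= t <= T -> u t x = g (t, x)) ->
  (forall (t : R) x, 0 <= t <= T -> h (rho t x) = eta (t, x)) ->
  euler_system T h rho u <->
  forall (t : R) x, 0 <= t <= T -> mass_residual R d r g (t, x) = 0 /\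
    forall j, momentum_residual R d eta g j (t, x) = 0.
Proof.
move=> T0 r1 g1 rE gE hE.
have E (t : R) x : 0 <= t <= T ->
    ddt T (fun s => rho s x) t + advect (u t x) (rho t) x
      + rho t x * div (u t) x = mass_residual R d r g (t, x) /\
    forall j, ddt T (fun s => u s x 0 j) t
      + advect (u t x) (fun y => u t y 0 j) x
      + grad (fun y => h (rho t y)) x 0 j = momentum_residual R d eta g j (t, x).
  move=> tT.
  have -> : (fun y => h (rho t y)) = fun y => eta (t, y) by apply/funext => y; exact: hE.
  have -> : rho t = fun y => r (t, y) by apply/funext => y; exact: rE.
  have -> : u t = fun y => g (t, y) by apply/funext => y; exact: gE.
  split.
    rewrite (ddt_val _ _ _ _ ('D_(1, 0) r (t, x)) T0 tT); last first.
      apply: (is_derive_is_ddt R R T (fun s => r (s, x)) _ t _ tT).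
        by move=> s sT; rewrite rE.
      exact: derive_time (r1.1 _).
    have -> : advect (g (t, x)) (fun y => r (t, y)) x =
        \sum_i g (t, x) 0 i * 'D_(0, delta_mx 0 i) r (t, x).
      by apply: eq_bigr => i _; rewrite /partial derive_space.
    have -> : div (fun y => g (t, y)) x = divergence R d g (t, x).
      apply: eq_bigr => i _; rewrite /partial.
      by rewrite (derive_space R d R (fun p => g p 0 i)).
    by [].
  move=> j; rewrite (ddt_val _ _ _ _ ('D_(1, 0) (fun p => g p 0 j) (t, x)) T0 tT); last first.
    apply: (is_derive_is_ddt R R T (fun s => g (s, x) 0 j) _ t _ tT).
      by move=> s sT; rewrite gE.
    exact: (derive_time R d (fun p => g p 0 j)) ((Ck1_coord R _ d g j g1).1 _).
  have -> : advect (g (t, x)) (fun y => g (t, y) 0 j) x =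
      \sum_i g (t, x) 0 i * 'D_(0, delta_mx 0 i) (fun p => g p 0 j) (t, x).
    apply: eq_bigr => i _; rewrite /partial.
    by rewrite (derive_space R d R (fun p => g p 0 j)).
  by rewrite /grad mxE /partial derive_space.
split=> H t x tT; have [E1 E2] := E t x tT; have [H1 H2] := H t x tT.
  by rewrite -E1; split=> // j; rewrite -E2.
by rewrite E1; split=> // j; rewrite E2.
Qed.

Lemma Rintegral_sum_mul (R : realType) (d : nat) (t : R) (b : 'I_d -> R)
    (Q : 'I_d -> R -> R) :
  (forall j, (@lebesgue_measure R).-integrable `[0, t] (EFin \o Q j)) ->
  \int[lebesgue_measure]_(s in `[0, t]) (\sum_j b j * Q j s) =
  \sum_j b j * \int[lebesgue_measure]_(s in `[0, t]) Q j s.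
Proof.
move=> iQ.
have ibQ j : (@lebesgue_measure R).-integrable `[0, t] (EFin \o (fun s => b j * Q j s)).
  exact: (integrableZl _ _ (iQ j)).
(* Integrability of the partial sums is carried through the induction, since additivity of the
   integral requires it. *)
have [] : (@lebesgue_measure R).-integrable `[0, t]
    (EFin \o (fun s => \sum_j b j * Q j s)) /\
  \int[lebesgue_measure]_(s in `[0, t]) (\sum_j b j * Q j s) =
  \sum_j b j * \int[lebesgue_measure]_(s in `[0, t]) Q j s; last by [].
elim: (index_enum 'I_d) => [|j I [iI IH]].
  split; first by under [X in EFin \o X]funext do rewrite big_nil; exact: integrable0.
  by under eq_Rintegral do rewrite big_nil; rewrite Rintegral_cst // mul0r big_nil.
split.
  under [X in EFin \o X]funext do rewrite big_cons.
  pose f1 s := b j * Q j s; pose f2 s := \sum_(j <- I) b j * Q j s.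
  have iS : (@lebesgue_measure R).-integrable `[0, t] ((EFin \o f1) \+ (EFin \o f2))%E.
    by apply: integrableD => //; exact: ibQ.
  by apply: eq_integrable iS => // s _; rewrite /= EFinD.
under eq_Rintegral do rewrite big_cons.
by rewrite RintegralD // RintegralZl // big_cons IH.
Qed.

(** * Equivalence on the domain, by transfer to labels *)

Theorem theorem3p1 (R : realType) (d : nat) (hd : d = 2%N \/ d = 3%N)
  (Om : domain) (T : R) (hT : 0 < T)
  (h : R -> R) (h0 : h 0 = 0)
  (rho0 : 'rV[R]_d -> R) (u0 : 'rV[R]_d -> 'rV[R]_d)
  (rho : R -> 'rV[R]_d -> R) (u : R -> 'rV[R]_d -> 'rV[R]_d)
  (rho0_dom : on_domain Om rho0) (u0_dom : on_domain Om u0)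
  (rho_dom : forall t, 0 <= t <= T -> on_domain Om (rho t))
  (u_dom : forall t, 0 <= t <= T -> on_domain Om (u t))
  (rho0_ge0 : forall x, 0 <= rho0 x)
  (rho_ge0 : forall t x, 0 <= t <= T -> 0 <= rho t x)
  (rho_smooth : smooth_slab T rho) (u_smooth : smooth_slab T u)
  (hrho_smooth : smooth_slab T (fun t x => h (rho t x)))
  (rho0_smooth : smooth rho0) (u0_smooth : smooth u0)
  (X A : R -> 'rV[R]_d -> 'rV[R]_d)
  (X_flow : is_flow T u X)
  (XA : forall t, 0 <= t <= T -> inverse_diffeos Om (X t) (A t)) :
  (euler_system T h rho u /\
     (forall x, rho 0 x = rho0 x /\ u 0 x = u0 x)) <->
  (density_formula T rho0 rho u X A /\ velocity_formula T h u0 rho u X A).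
Proof.
have [r [/(_ 1%N) r1 rE]] := rho_smooth.
have [g [/(_ 1%N) g1 gE]] := u_smooth.
have [eta [/(_ 1%N) e1 hE]] := hrho_smooth.
have T00 : 0 <= (0 : R) <= T by rewrite lexx ltW.
have HX a : X 0 a = a /\
    forall t : R, 0 <= t <= T -> is_ddt T (fun s => X s a) t (g (t, X t a)).
  by have [X0 HXa] := X_flow a; split => // t tT; rewrite -gE //; exact: HXa.
have dX (t : R) a : 0 <= t <= T -> differentiable (X t) a.
  by move=> /XA[[/(_ 1%N)[]]].
have dA (t : R) a : 0 <= t <= T -> differentiable (A t) a.
  by move=> /XA[[_ /(_ 1%N)[]]].
have AX (t : R) : 0 <= t <= T -> exists2 c, lattice Om c & forall x, A t (X t x) = x + c.
  move=> tT; have [_ _ _ H _] := XA t tT; apply: lattice_valued_constant => // x.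
  by apply: continuous_comp; apply: differentiable_continuous; [exact: dX|exact: dA].
have XtA (t : R) : 0 <= t <= T -> exists2 c, lattice Om c & forall x, X t (A t x) = x + c.
  move=> tT; have [_ _ _ _ H] := XA t tT; apply: lattice_valued_constant => // x.
  by apply: continuous_comp; apply: differentiable_continuous; [exact: dA|exact: dX].
(* A translation is onto, so surjectivity holds for the lifts on R^d and not only modulo the
   lattice. *)
have A_surj (t : R) a : 0 <= t <= T -> exists x, A t x = a.
  by move=> tT; have [c _ H] := AX t tT; exists (X t (a - c)); rewrite H subrK.
have X_surj (t : R) x : 0 <= t <= T -> exists a, X t a = x.
  by move=> tT; have [c _ H] := XtA t tT; exists (A t (x - c)); rewrite H subrK.
pose Y (s : R) a j k := 'D_(delta_mx 0 j) (fun x => X s x 0 k) a.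
pose Z (t : R) x i j := 'D_(delta_mx 0 i) (fun x => A t x 0 j) x.
(* Differentiating [X t (A t x) = x + c] by the chain rule: the constant [c] disappears. *)
have ZY (t : R) x : 0 <= t <= T ->
    (\matrix_(i, j) Z t x i j) *m (\matrix_(j, k) Y t (A t x) j k) = 1%:M.
  move=> tT; have [c _ Hc] := XtA t tT; apply/matrixP => i k; rewrite !mxE.
  rewrite -(derive_id_coord R d (fun y => X t (A t y)) c x i k) //.
  rewrite (derive_rV_comp R _ d (fun x => X t x 0 k)) //; last exact: dA.
    by apply: eq_bigr => j _; rewrite !mxE.
  apply: (@differentiable_comp _ _ _ _ (X t) (fun M : 'rV[R]_d => M 0 k)); first exact: dX.
  exact: differentiable_coord.
(* [P] and [V] are the left-hand sides of the density and Weber equations at a fixed label [a]. *)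
pose P (t : R) a := r (t, X t a) - rho0 a + \int[lebesgue_measure]_(s in `[0, t])
  (r (s, X s a) * divergence R d g (s, X s a)).
pose Q (s : R) a j := \sum_k Y s a j k
  * 'D_(0, delta_mx 0 k) (weber_potential R d eta g) (s, X s a).
pose V (t : R) a j := \sum_k g (t, X t a) 0 k * Y t a j k - u0 a 0 j
  + \int[lebesgue_measure]_(s in `[0, t]) Q s a j.
have densityE (t : R) x : 0 <= t <= T -> rho t x - rho0 (A t x)
      + \int[lebesgue_measure]_(s in `[0, t])
          (rho s (position_at X A s t x) * div (u s) (position_at X A s t x))
    = P t (A t x).
  move=> tT; have [c Lc Hc] := XtA t tT.
  have IE : \int[lebesgue_measure]_(s in `[0, t])
      (rho s (position_at X A s t x) * div (u s) (position_at X A s t x)) =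
      \int[lebesgue_measure]_(s in `[0, t])
        (r (s, X s (A t x)) * divergence R d g (s, X s (A t x))).
    apply: eq_Rintegral => s; rewrite inE /= in_itv /= => /andP[s0 st].
    have sT : 0 <= s <= T by rewrite s0 (le_trans st) //; case/andP: tT.
    rewrite (rE s) // /position_at.
    have -> : u s = fun y => g (s, y) by apply/funext => y; exact: gE.
    have -> : div (fun y => g (s, y)) (X s (A t x)) = divergence R d g (s, X s (A t x)).
      apply: eq_bigr => i _; rewrite /partial.
      by rewrite (derive_space R d R (fun p => g p 0 i)).
    by [].
  (* The discrepancy [c] between [X t (A t x)] and [x] is a lattice vector, absorbed by the
     periodicity of [rho t]. *)
  by rewrite IE /P -(rE t _ tT) Hc (rho_dom t tT x c Lc).
have velocityE (t : R) x i : 0 <= t <= T ->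
    u t x 0 i - grad_adjoint (A t) x (u0 (A t x)) 0 i
      + \int[lebesgue_measure]_(s in `[0, t])
          grad (fun y => h (rho s (position_at X A s t y))
                         - 2^-1 * sqnorm (u s (position_at X A s t y))) x 0 i
    = \sum_j Z t x i j * V t (A t x) j.
  move=> tT; have [c Lc Hc] := XtA t tT.
  have sT (s : R) : s \in `[0, t]%classic -> 0 <= s <= T.
    rewrite inE /= in_itv /= => /andP[s0 st].
    by rewrite s0 (le_trans st) //; case/andP: tT.
  have IE : \int[lebesgue_measure]_(s in `[0, t])
      grad (fun y => h (rho s (position_at X A s t y))
                     - 2^-1 * sqnorm (u s (position_at X A s t y))) x 0 i =
      \sum_j Z t x i j * \int[lebesgue_measure]_(s in `[0, t]) Q s (A t x) j.
    rewrite -(Rintegral_sum_mul R d t (Z t x i) (fun j s => Q s (A t x) j)).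
      apply: eq_Rintegral => s /sT {}sT; rewrite /grad mxE /partial.
      (* For fixed [s] the potential is a function of the label composed with [A t], so the chain
         rule pulls the factor [Z] out, and this factor does not depend on [s]. *)
      have -> : (fun y => h (rho s (position_at X A s t y))
          - 2^-1 * sqnorm (u s (position_at X A s t y))) =
          (fun y => (fun b => weber_potential R d eta g (s, X s b)) (A t y)).
        by apply/funext => y; rewrite hE // gE.
      have dW p := weber_potential_differentiable R d eta g p e1 g1.
      rewrite (derive_rV_comp R _ d (fun b => weber_potential R d eta g (s, X s b)));
        [|by apply: differentiable_space; [exact: dW|exact: dX]|exact: dA].
      apply: eq_bigr => j _; rewrite derive_space_comp //; exact: dX.
    move=> j; have [q [qE cq]] := weber_integrand_extend R d T eta g X (A t x) j hT e1 g1 HX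
      (fun t tT => dX t _ tT).
    have iq := continuous_segment_integrable R T q t cq (proj2 (andP tT)).
    by apply: eq_integrable iq => // s /sT {}sT /=; rewrite qE.
  rewrite IE /V; under [RHS]eq_bigr do rewrite mulrDr mulrBr.
  rewrite big_split /= sumrB; congr (_ - _ + _); last by rewrite /grad_adjoint mxE.
  under eq_bigr do rewrite mulr_sumr.
  rewrite exchange_big /= -(u_dom t tT x c Lc) -Hc gE //.
  have ZYE k : \sum_j Z t x i j * Y t (A t x) j k = (i == k)%:R.
    have := congr1 (fun M : 'M[R]_d => M i k) (ZY t x tT); rewrite !mxE => <-.
    by apply: eq_bigr => j _; rewrite !mxE.
  (* The velocity term needs no derivative of [u]: it is rewritten by inserting the identity matrix
     as the product of [Z] and [Y]. *)
  transitivity (\sum_k g (t, X t (A t x)) 0 k * (i == k)%:R).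
    rewrite (bigD1 i) //= eqxx mulr1 big1 ?addr0 // => k ki.
    by rewrite eq_sym (negbTE ki) mulr0.
  apply: eq_bigr => k _; rewrite -ZYE mulr_sumr.
  by apply: eq_bigr => j _; rewrite mulrCA.
have rho_equiv a := lagrangian_density_equiv R d T r g X a (rho0 a) hT r1 g1 (HX a).1 (HX a).2.
have u_equiv a j := lagrangian_velocity_equiv R d T eta g X a j (u0 a 0 j) hT e1 g1 HX
  (fun t tT => dX t a tT).
have Euler_equiv := euler_system_residuals R d T h rho u r eta g hT r1 g1 rE gE hE.
split=> [[/Euler_equiv HE Hinit]|[HP HV]].
  split=> [t x tT|t x tT i].
    rewrite densityE //; apply: (rho_equiv (A t x)).2 => //.
    split; first by rewrite -rE // (Hinit _).1.
    by move=> s sT; exact: (HE _ _ sT).1.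
  rewrite velocityE // big1 // => j _.
  rewrite [V _ _ _](u_equiv (A t x) j).2 ?mulr0 //.
  split; first by rewrite -gE // (Hinit _).2.
  by move=> s sT; rewrite big1 // => k _; rewrite (HE _ _ sT).2 mulr0.
(* Every label is some [A t x], so the formulas in [x] yield the equations at all labels. *)
have {}HP (t : R) a : 0 <= t <= T -> P t a = 0.
  by move=> tT; have [x <-] := A_surj t a tT; rewrite -densityE // HP.
have {}HV (t : R) a j : 0 <= t <= T -> V t a j = 0.
  move=> tT; have [x <-] := A_surj t a tT.
  (* Here [Z] must be cancelled, so its right inverse [Y] is used as a left inverse, legitimate for
     square matrices. *)
  apply: (left_inverse_mx_eq0 R d _ _ (V t (A t x)) (mulmx1C (ZY t x tT))) => i.
  by rewrite -[RHS](HV t x tT i) velocityE //; apply: eq_bigr => k _; rewrite mxE.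
have {}rho_equiv a := (rho_equiv a).1 (fun t tT => HP t a tT).
have {}u_equiv a j := (u_equiv a j).1 (fun t tT => HV t a j tT).
split; last first.
  move=> x; rewrite rE // gE // (rho_equiv x).1; split => //.
  by apply/rowP => j; rewrite (u_equiv x j).1.
apply/Euler_equiv => t x tT; have [a <-] := X_surj t x tT.
split; first exact: (rho_equiv a).2.
(* Choosing [x'] with [A t x' = a] makes [Z t x'] a left inverse of the flow gradient at [a], which
   then cancels from the momentum equation. *)
have [x' Ax'] := A_surj t a tT.
apply: (left_inverse_mx_eq0 R d _ _ _ (ZY t x' tT)) => i.
rewrite -[RHS]((u_equiv a i).2 t tT); apply: eq_bigr => k _.
by rewrite mxE Ax'.
Qed.
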